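(* Let $N\in\mathbb{Z}$ with $|N|>1$ and let $\mathcal{D}\subset\mathbb{Z}$ be a finite set that is a complementing set $(\mathrm{mod}\ N)$. Suppose that the cardinality $|\mathcal{D}|$ has no more than two distinct prime factors. Then $\mu_{N,\mathcal{D}}$ is a spectral measure.
   Context: A finite set $\mathcal{D}\subset\mathbb{Z}$ is called a complementing set $(\mathrm{mod}\ N)$ if there exists $\mathcal{E}\subset\mathbb{Z}$ such that $\mathcal{D}\oplus\mathcal{E}$ is a complete residue system $(\mathrm{mod}\ N)$; here $\oplus$ means that every element of $\mathcal{D}+\mathcal{E}$ has a unique representation $d+\epsilon$ with $d\in\mathcal{D}$, $\epsilon\in\mathcal{E}$. Write $e(t)=e^{2\pi i t}$. A probability measure $\mu$ on $\mathbb{R}$ is called a spectral measure if there exists a set $\Lambda\subset\mathbb{R}$ such that the functions $t\mapsto e(\lambda t)$, $\lambda\in\Lambda$, form an orthonormal basis of $L^2(\mu)$. For an integer $N$ with $|N|>1$ and a finite set $\mathcal{D}=\{d_1,\dots,d_q\}\subset\mathbb{Z}$ of cardinality $q$, $\mu_{N,\mathcal{D}}$ denotes the unique Borel probability measure on $\mathbb{R}$ satisfying $\mu=\sum_{j=1}^q \frac1q\,\mu\circ\phi_j^{-1}$, where $\phi_j(x)=\frac1N(x+d_j)$. *)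

(* Defs.v *)
From HB Require Import structures.
From mathcomp Require Import all_boot all_order all_algebra finmap complex.
From mathcomp Require Import all_classical all_reals all_analysis.
Import Order.TTheory GRing.Theory Num.Theory numFieldNormedType.Exports.

Set Implicit Arguments.
Unset Strict Implicit.
Unset Printing Implicit Defensive.

Local Open Scope classical_set_scope.
Local Open Scope ring_scope.

(** * Complementing sets *)

Definition sumset (A B : set int) : set int := [set a + b | a in A & b in B].

Definition direct_sum (A B : set int) : Prop :=
  forall a a' b b' : int, A a -> A a' -> B b -> B b' ->
    a + b = a' + b' -> a = a' /\ b = b'.

Definition complete_residue_system (N : int) (S : set int) : Prop :=
  forall z : int, exists! s : int, S s /\ (s = z %[mod N])%Z.

Definition complementing (N : int) (D : set int) : Prop :=
  exists E : set int,
    direct_sum D E /\ complete_residue_system N (sumset D E).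

(** * Complex-valued functions on the line *)

Section spectral.
Context {R : realType}.
Implicit Types (mu : {measure set (measurableTypeR R) -> \bar R}).
Implicit Types (f g : R -> R[i]).

(* [e2pi t] is exp (2 pi i t). *)
Definition e2pi (t : R) : R[i] :=
  Complex (cos (2 * pi * t)) (sin (2 * pi * t)).

Definition exponential (lambda : R) : R -> R[i] := fun t => e2pi (lambda * t).

Definition cmeasurable f : Prop :=
  measurable_fun [set: measurableTypeR R] (fun t => complex.Re (f t)) /\
  measurable_fun [set: measurableTypeR R] (fun t => complex.Im (f t)).

Definition cintegral mu f : R[i] :=
  Complex (\int[mu]_t complex.Re (f t)) (\int[mu]_t complex.Im (f t)).

Definition L2norm mu f : \bar R :=
  'N[mu]_(2%:E)[(fun t => (Normc.normc (f t))%:E)]%E.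

Definition L2 mu : set (R -> R[i]) :=
  [set f | cmeasurable f /\ (L2norm mu f < +oo)%E].

Definition L2dot mu f g : R[i] := cintegral mu (fun t => f t * conjc (g t)).

Definition orthonormal_exponentials mu (Lambda : set R) : Prop :=
  forall l l' : R, Lambda l -> Lambda l' ->
    L2dot mu (exponential l) (exponential l') = (l == l')%:R.

(* The finite linear combinations are dense in L2(mu). *)
Definition total_exponentials mu (Lambda : set R) : Prop :=
  forall f : R -> R[i], L2 mu f -> forall eps : R, 0 < eps ->
    exists (s : seq R) (c : R -> R[i]),
      (forall l, l \in s -> Lambda l) /\
      (L2norm mu (fun t => f t - \sum_(l <- s) c l * exponential l t)%R
         < eps%:E)%E.

Definition spectral_measure mu : Prop :=
  exists Lambda : set R,
    orthonormal_exponentials mu Lambda /\ total_exponentials mu Lambda.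

(** * Self-similar measures *)

Definition phi (N d : int) : measurableTypeR R -> measurableTypeR R :=
  fun x : R => N%:~R^-1 * (x + d%:~R).

(* The equation characterizing the measure mu_{N,D} among Borel probability
   measures; when `|N| > 1 and D is nonempty it has exactly one solution
   (Hutchinson). *)
Definition self_similar (N : int) (D : {fset int}) mu : Prop :=
  forall A : set (measurableTypeR R), measurable A ->
    mu A = (\sum_(d <- D) (#|` D|%:R^-1)%:E * pushforward mu (phi N d) A)%E.

End spectral.

(* Main.v *)
(** The mask polynomial of a tile [A] of Z/N vanishes at roots of unity of certain prime power
    orders.  When [#|A|] has at most two prime factors [p] and [r], a dilation argument
    (Tijdeman) replaces [N] by its {p, r}-part, and Sands' theorem then shows, by induction on
    [N], that vanishing at the orders [p ^ i] and [r ^ j] forces vanishing at [p ^ i * r ^ j]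
    (condition (T2) of Coven and Meyerowitz).  Hence the digit expansions with free digits at
    the places given by the vanishing orders form a set [S] for which the matrix of the
    exponentials [e(d s / N)] is unitary up to scaling (Laba).

    Let [w = |mu^|^2] and let [M] be the squared modulus of the mask of [D], so that
    [w x = M (x / N) * w (x / N)] and [sum_s M ((x + s) / N) = 1].  After dividing out the gcd
    of the differences of [D], no class of R/Z consists of zeros of [w]: such classes would form
    a finite set on which [M = 1], hence contain 0.  By compactness one can therefore add
    multiples of [N ^ n.+1] to the expansions [sum_k s_k N ^ k], keeping orthogonality, so
    that the resulting frequencies satisfy [w ((x + l) / N ^ n) >= e > 0] uniformly; the
    partial sums of [w (x + l)] then increase to 1 for every [x].  By Parseval every exponential
    lies in the closed span of the chosen ones, and all exponentials together are dense in
    L2. *)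

Require Import Defs.
From mathcomp Require Import all_boot all_order all_algebra all_field finmap complex.
From mathcomp Require Import all_classical all_reals all_analysis.
From mathcomp Require Import measurable_realfun.
From mathcomp Require Import zify ring lra.

Set Implicit Arguments.
Unset Strict Implicit.
Unset Printing Implicit Defensive.
Import Order.TTheory GRing.Theory Num.Theory numFieldNormedType.Exports.
Import HBNNSimple.
Local Open Scope ring_scope.

(** * Tilings of cyclic groups *)

(** Plain digit expansions give orthogonality but not completeness: for N = 2 and D = {0, 1}, mu is
    Lebesgue measure on [0, 1], and the digits 0, 1 produce only the nonnegative integers. The
    weights [prodM n (x + l)] always have total mass 1 on the n-th list, but part of this mass may
    sit on frequencies that run off with n and be lost in the limit [w (x + l)]. A lower bound for
    [w] at the rescaled frequencies makes each weight at most [w (x + l) / e] and so prevents the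
    loss. Two primes matter in Sands' theorem: a set that meets two classes modulo each prime factor
    of N must have a difference prime to N. With three primes this fails, as {0, 6, 10, 15} modulo
    30 shows. The gcd g is divided out because the mask has modulus 1 at all multiples of 1/g, so
    that M = 1 would not single out the class of 0. *)

(* Only the entries of [A] and [B] modulo [N] matter. *)
Definition tile (N : nat) (A B : seq nat) : Prop :=
  forall c, (\sum_(a <- A) \sum_(b <- B) (a + b == c %[mod N]) = 1)%N.

Section Tiling.
Local Open Scope nat_scope.

Lemma tileC N A B : tile N A B -> tile N B A.
Proof.
move=> t c; rewrite exchange_big -(t c).
by apply: eq_bigr => a _; apply: eq_bigr => b _; rewrite addnC.
Qed.

Lemma sum_mod_eq N x : 0 < N -> \sum_(c < N) (x == c %[mod N]) = 1.
Proof.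
move=> N0; have xN : x %% N < N by rewrite ltn_mod.
rewrite (bigD1 (Ordinal xN)) //= modn_mod eqxx big1 ?addn0 // => c cx.
rewrite (modn_small (ltn_ord c)); apply/eqP; rewrite eqb0.
by apply: contra cx => /eqP cx; apply/eqP/val_inj.
Qed.

Lemma tile_size N A B : 0 < N -> tile N A B -> size A * size B = N.
Proof.
move=> N0 t; rewrite -[RHS]muln1 -[N in RHS]card_ord -sum_nat_const.
under [RHS]eq_bigr => c _ do rewrite -(t c).
rewrite exchange_big -!sum1_size big_distrl; apply: eq_bigr => a _ /=.
rewrite exchange_big mul1n; apply: eq_bigr => b _ /=.
by rewrite sum_mod_eq.
Qed.

(** Pigeonhole: the [N] counts are positive and add up to [size A * size B = N]. *)
Lemma tile_sumset_full N A B : 0 < N -> size A * size B = N ->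
  (forall c, 0 < \sum_(a <- A) \sum_(b <- B) (a + b == c %[mod N])) ->
  tile N A B.
Proof.
move=> N0 sAB pos c.
pose F (c : 'I_N) := \sum_(a <- A) \sum_(b <- B) (a + b == c %[mod N]).
have sF : \sum_(c < N) F c = \sum_(c < N) 1.
  have -> : \sum_(c < N) 1 = N by rewrite sum_nat_const card_ord muln1.
  rewrite -[RHS]sAB -!sum1_size big_distrl exchange_big.
  apply: eq_bigr => a _ /=; rewrite exchange_big mul1n; apply: eq_bigr => b _ /=.
  by rewrite sum_mod_eq.
have F1 (i : 'I_N) : F i = 1.
  have := sF; rewrite (bigD1 i) // (bigD1 i (F := fun=> 1)) //=.
  have : \sum_(j < N | j != i) 1 <= \sum_(j < N | j != i) F j.
    by apply: leq_sum => j _; exact: pos.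
  have := pos i; rewrite -/(F i).
  move: (F i) (\sum_(j < N | j != i) 1) (\sum_(j < N | j != i) F j).
  by clear; lia.
have cN : c %% N < N by rewrite ltn_mod.
rewrite -[RHS](F1 (Ordinal cN)); apply: eq_bigr => a _; apply: eq_bigr => b _ /=.
by rewrite modn_mod.
Qed.

End Tiling.

Section Frobenius.
Variables (k : nat) (k_pr : prime k).
Local Notation F := 'F_k.

Let Kc : k \in [pchar {poly F}].
Proof. by rewrite pchar_poly pchar_Fp. Qed.

Lemma poly_expr_prime (A : seq nat) :
  (\sum_(a <- A) 'X^a) ^+ k = \sum_(a <- A) 'X^(k * a) :> {poly F}.
Proof.
rewrite -(pFrobenius_autE Kc) rmorph_sum; apply: eq_bigr => a _ /=.
by rewrite pFrobenius_autE -exprM mulnC.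
Qed.

End Frobenius.

Section CyclicPoly.
Variables (F : fieldType) (N : nat) (N0 : (0 < N)%N).
Let d : {poly F} := 'X^N - 1.
Let U : {poly F} := \sum_(i < N) 'X^i.

Lemma dvdp_Xn_mod n : d %| 'X^n - 'X^(n %% N).
Proof.
rewrite {1}(divn_eq n N) exprD mulnC exprM -[X in _ - X]mul1r -mulrBl.
by rewrite dvdp_mulr // -[X in _ - X](expr1n _ (n %/ N)) subrXX dvdp_mulIl.
Qed.

(** Modulo [X^N - 1], multiplication by [X] fixes [U], so a polynomial acts on [U] as its value at
    1. *)
Lemma dvdp_U_mul (A : seq nat) j :
  d %| (\sum_(a <- A) 'X^a) ^+ j * U - (size A ^ j)%:R * U.
Proof.
have UX a : d %| 'X^a * U - U.
  rewrite -[X in _ - X]mul1r -mulrBl -(expr1n _ a) subrXX mulrAC dvdp_mulr //.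
  by rewrite /d (subrX1 'X N) dvdpp.
have UA : d %| (\sum_(a <- A) 'X^a) * U - (size A)%:R * U.
  rewrite -sum1_size natr_sum -mulrBl -sumrB mulr_suml big_seq.
  apply: (big_ind (fun p => _ %| p)) => [|x y dx dy|a _]; rewrite ?dvdp0 ?dvdp_add //.
  by rewrite mulrBl mul1r.
elim: j => [|j IH]; first by rewrite expr0 expn0 subrr dvdp0.
rewrite exprS expnS natrM.
set P := \sum_(a <- A) _ in UA IH *.
have -> : P * P ^+ j * U - (size A)%:R * (size A ^ j)%:R * U
  = P * (P ^+ j * U - (size A ^ j)%:R * U)
    + (size A ^ j)%:R * (P * U - (size A)%:R * U) by ring.
by rewrite dvdp_add // dvdp_mull.
Qed.

Lemma coef_sum_X (A B : seq nat) (f : nat -> nat -> nat) (c : nat) :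
  (\sum_(a <- A) \sum_(b <- B) 'X^(f a b) : {poly F})`_c
  = (\sum_(a <- A) \sum_(b <- B) (c == f a b))%:R.
Proof.
rewrite coef_sum natr_sum; apply: eq_bigr => a _.
by rewrite coef_sum natr_sum; apply: eq_bigr => b _; rewrite coefXn.
Qed.

Lemma coef_U c : U`_c = (c < N)%:R.
Proof.
have -> : U = \poly_(i < N) 1.
  by rewrite poly_def; apply: eq_bigr => i _; rewrite scale1r.
by rewrite coef_poly; case: ltnP.
Qed.

(** The bound on [f] keeps both polynomials of degree less than [N], so a difference divisible by
    [X^N - 1] is zero. In use, [f] is addition reduced modulo [N]. *)
Lemma tile_poly_eq (A B : seq nat) (f : nat -> nat -> nat) : (forall a b, f a b < N)%N ->
  d %| \sum_(a <- A) \sum_(b <- B) 'X^(f a b) - U ->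
  forall c, (\sum_(a <- A) \sum_(b <- B) (c == f a b))%:R = (c < N)%:R :> F.
Proof.
move=> fN dvd c; rewrite -coef_sum_X -coef_U.
suff -> : \sum_(a <- A) \sum_(b <- B) 'X^(f a b) = U :> {poly F} by [].
apply/eqP; rewrite -subr_eq0; apply: contraLR dvd => nz.
apply: contra nz => /dvdp_leq; case: eqP => // _ /(_ isT); apply: contraLR => _.
rewrite -ltnNge size_XnsubC // ltnS; apply/leq_sizeP => j Nj.
rewrite coefB coef_sum_X coef_U ltnNge Nj subr0 big1 // => a _.
rewrite big1 // => b _; apply/eqP; rewrite eqb0; apply: contraTneq Nj => ->.
by rewrite -ltnNge.
Qed.

End CyclicPoly.

(* Tijdeman: modulo [k] and [X^N - 1], [A(X^k) B(X) = A(X)^k B(X)] is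
   [#|A|^(k-1) (1 + ... + X^(N-1))], so every class modulo [N] is hit, and by counting
   exactly once. *)
Lemma tile_mul_prime k N A B : (0 < N)%N -> prime k -> coprime k (size A) ->
  tile N A B -> tile N (map (muln k) A) B.
Proof.
move=> N0 kp kA t.
apply: tile_sumset_full => // [|c]; first by rewrite size_map (tile_size N0 t).
pose F : fieldType := 'F_k.
pose PA : {poly F} := \sum_(a <- A) 'X^a.
pose PB : {poly F} := \sum_(b <- B) 'X^b.
pose U : {poly F} := \sum_(i < N) 'X^i.
have dAB : 'X^N - 1 %| PA * PB - U.
  have -> : PA * PB - U = \sum_(a <- A) \sum_(b <- B) ('X^(a + b) - 'X^((a + b) %% N)).
    under eq_bigr do rewrite sumrB.
    rewrite sumrB; congr (_ - _).
      rewrite mulr_suml; apply: eq_bigr => a _; rewrite mulr_sumr.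
      by apply: eq_bigr => b _; rewrite exprD.
    apply/polyP => i; rewrite coef_sum_X coef_U; congr _%:R.
    case: ltnP => iN.
      transitivity 1%N => //; rewrite -(t i); apply: eq_bigr => a _; apply: eq_bigr => b _.
      by rewrite (modn_small iN) eq_sym.
    rewrite big1 // => a _; rewrite big1 // => b _; apply/eqP; rewrite eqb0.
    by rewrite neq_ltn (leq_trans _ iN) ?orbT ?ltn_mod.
  apply: (big_ind (fun p => _ %| p)) => [|x y dx dy|a _]; [exact: dvdp0|exact: dvdp_add|].
  apply: (big_ind (fun p => _ %| p)) => [|x y dx dy|b _]; [exact: dvdp0|exact: dvdp_add|].
  exact: dvdp_Xn_mod.
have dvd : 'X^N - 1 %|
    \sum_(a <- map (muln k) A) \sum_(b <- B) 'X^((a + b) %% N) - U.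
  have dU : 'X^N - 1 %| PA ^+ k * PB - U.
    have -> : PA ^+ k * PB - U = PA ^+ k.-1 * (PA * PB - U)
        + (PA ^+ k.-1 * U - (size A ^ k.-1)%:R * U)
        + ((size A ^ k.-1)%:R - 1) * U.
      by rewrite -{1}(prednK (prime_gt0 kp)) exprSr; ring.
    apply: dvdp_add; first by apply: dvdp_add; [exact: dvdp_mull|exact: dvdp_U_mul].
    have -> : (size A ^ k.-1)%:R = 1 :> {poly F}.
      rewrite -polyC_natr -[RHS]polyC1; congr (_%:P); rewrite natrX.
      have A0 : (size A)%:R != 0 :> F.
        by rewrite -(dvdn_pcharf (pchar_Fp kp)) -prime_coprime.
      apply: (mulfI A0); rewrite -exprS prednK ?prime_gt0 // mulr1.
      by rewrite -[in LHS](card_Fp kp) expf_card.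
    by rewrite subrr mul0r dvdp0.
  rewrite poly_expr_prime // in dU.
  set L := (X in _ %| X - _) in dU; set L' := (X in _ %| X - _).
  rewrite -[L'](subrK L) -addrA dvdp_add // -dvdpNr opprB.
  have -> : L - L' =
      \sum_(a <- map (muln k) A) \sum_(b <- B) ('X^(a + b) - 'X^((a + b) %% N)).
    under eq_bigr do rewrite sumrB.
    rewrite sumrB; congr (_ - _).
    rewrite /L mulr_suml [RHS]big_map; apply: eq_bigr => a _; rewrite mulr_sumr.
    by apply: eq_bigr => b _; rewrite exprD.
  apply: (big_ind (fun p => _ %| p)) => [|x y dx dy|a _]; [exact: dvdp0|exact: dvdp_add|].
  apply: (big_ind (fun p => _ %| p)) => [|x y dx dy|b _]; [exact: dvdp0|exact: dvdp_add|].
  exact: dvdp_Xn_mod.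
have := @tile_poly_eq F N N0 (map (muln k) A) B (fun a b => (a + b) %% N)%N _ dvd (c %% N)%N.
rewrite ltn_mod N0 => E; have {}E := E (fun a b => ltn_pmod (a + b) N0).
(* The coefficients are known only modulo [k], which is enough to exclude a count of 0. *)
rewrite lt0n; apply/eqP => S0; move: E; rewrite (_ : (\sum_(a <- _) _)%N = 0%N).
  by move/eqP; rewrite eq_sym oner_eq0.
rewrite -[RHS]S0; apply: eq_bigr => a _; apply: eq_bigr => b _.
by rewrite eq_sym.
Qed.

(** * Vanishing of mask polynomials at roots of unity *)

Lemma root_prod_intr (F : idomainType) (s : seq nat) (f : nat -> {poly int}) (z : F) :
  root (map_poly intr (\prod_(d <- s) f d)) z
  = has (fun d => root (map_poly intr (f d)) z) s.
Proof.
elim: s => [|d s IH]; first by rewrite big_nil rmorph1 (negPf (root1 _)).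
by rewrite big_cons rmorphM rootM IH.
Qed.

(** As [z ^+ n = 1], some [Phi_d] with [d] dividing [n] vanishes at [z]; then [z ^+ d = 1] forces
    [d = n]. *)
Lemma root_Cyclotomic (F : idomainType) n (z : F) :
  n.-primitive_root z -> root (map_poly intr 'Phi_n) z.
Proof.
move=> prim_z; have n0 := prim_order_gt0 prim_z.
have : root (map_poly intr (\prod_(d <- divisors n) 'Phi_d)) z.
  rewrite prod_Cyclotomic // rmorphB rmorph1 /= map_polyXn /root !hornerE.
  by rewrite (prim_expr_order prim_z) subrr.
rewrite root_prod_intr => /hasP[d]; rewrite -dvdn_divisors // => dn rz.
suff /eqP : z ^+ d = 1.
  rewrite -(prim_order_dvd prim_z) => nd.
  by have /eqP <- : d == n by rewrite eqn_dvd dn.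
have d0 : (0 < d)%N by rewrite (dvdn_gt0 n0 dn).
have : root (map_poly intr ('X^d - 1) : {poly F}) z.
  rewrite -prod_Cyclotomic // root_prod_intr; apply/hasP; exists d => //.
  by rewrite -dvdn_divisors.
by rewrite rmorphB rmorph1 /= map_polyXn /root !hornerE subr_eq0 => /eqP.
Qed.

(** [Phi_n] is the minimal polynomial of [z] over the rationals. The remainder of [q] by the monic
    [Phi_n] has integer coefficients, vanishes at [z] and has smaller degree, hence is zero. *)
Lemma rdvdp_CyclotomicP n (z : algC) (q : {poly int}) : n.-primitive_root z ->
  root (map_poly intr q) z -> Pdiv.Ring.rdvdp 'Phi_n q.
Proof.
move=> prim_z rz; have mon := Cyclotomic_monic n.
have n0 := prim_order_gt0 prim_z.
rewrite /Pdiv.Ring.rdvdp; apply: contraTT (rz) => nz.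
rewrite {1}(Pdiv.RingMonic.rdivp_eq mon q) rmorphD rmorphM /=.
rewrite /root hornerD hornerM (eqP (root_Cyclotomic prim_z)) mulr0 add0r.
have [pf [Dpf mon_pf] dv_pf] := minCpolyP z.
set r := Pdiv.Ring.rmodp _ _ in nz *.
have intrE : map_poly intr r = map_poly ratr (map_poly intr r : {poly rat}) :> {poly algC}.
  by rewrite -map_poly_comp; apply: eq_map_poly => a; rewrite /= rmorph_int.
rewrite intrE -/(root _ z) dv_pf; apply/negP => /dvdp_leq.
rewrite map_poly_eq0_id0 ?intr_eq0 ?lead_coef_eq0 // => /(_ nz).
apply/negP; rewrite -ltnNge size_map_inj_poly //; last exact: intr_inj.
have <- : size 'Phi_n = size pf.
  rewrite -(size_map_inj_poly (intr_inj : injective (intr : int -> algC))) //.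
  rewrite (Cintr_Cyclotomic prim_z) -(minCpoly_cyclotomic prim_z) Dpf.
  by rewrite size_map_poly.
exact/Pdiv.Ring.ltn_rmodpN0/monic_neq0.
Qed.

Definition mask_poly (A : seq nat) : {poly int} := \sum_(a <- A) 'X^a.

(* Divisibility over the integers makes the vanishing independent of the primitive root and of
   the domain in which it is taken. *)
Definition vanishes_at (A : seq nat) (n : nat) : bool := Pdiv.Ring.rdvdp 'Phi_n (mask_poly A).

Lemma horner_mask (F : comNzRingType) A (z : F) :
  (map_poly intr (mask_poly A)).[z] = \sum_(a <- A) z ^+ a.
Proof.
rewrite /mask_poly rmorph_sum horner_sum; apply: eq_bigr => a _ /=.
by rewrite map_polyXn hornerXn.
Qed.

Lemma vanishes_at_sum (F : idomainType) A n (z : F) : n.-primitive_root z ->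
  vanishes_at A n -> \sum_(a <- A) z ^+ a = 0.
Proof.
move=> prim_z /(Pdiv.RingMonic.rdvdpP (Cyclotomic_monic n))[C AC].
by rewrite -horner_mask AC rmorphM hornerM (eqP (root_Cyclotomic prim_z)) mulr0.
Qed.

Lemma sum_vanishes_at A n (z : algC) : n.-primitive_root z ->
  \sum_(a <- A) z ^+ a = 0 -> vanishes_at A n.
Proof.
move=> prim_z E; apply: (rdvdp_CyclotomicP prim_z).
by rewrite /root horner_mask E.
Qed.

Lemma vanishes_atE A n (z : algC) : n.-primitive_root z ->
  vanishes_at A n = (\sum_(a <- A) z ^+ a == 0).
Proof.
move=> prim_z; apply/idP/eqP; first exact: vanishes_at_sum.
exact: sum_vanishes_at.
Qed.

(** The polynomial is the quotient of [X^(p^(a+1)) - 1] by [X^(p^a) - 1], a geometric sum of [p]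
    terms. *)
Lemma Cyclotomic_prime_power p a : prime p -> ('Phi_(p ^ a.+1)).[1] = p%:R.
Proof.
move=> pp; have p0 := prime_gt0 pp.
have pa n : (0 < p ^ n)%N by rewrite expn_gt0 p0.
suff -> : 'Phi_(p ^ a.+1) = \sum_(i < p) ('X^(p ^ a)) ^+ i.
  rewrite horner_sum (eq_bigr (fun=> 1)) ?sumr_const ?card_ord // => i _.
  by rewrite -exprM hornerXn expr1n.
have nz : 'X^(p ^ a) - 1 != 0 :> {poly int} by rewrite monic_neq0 ?monicXnsubC.
apply: (mulfI nz); rewrite -subrX1 -exprM -expnSr.
rewrite -!prod_Cyclotomic // mulrC.
have -> : 'Phi_(p ^ a.+1) * \prod_(d <- divisors (p ^ a)) 'Phi_d
    = \prod_(d <- (p ^ a.+1 :: divisors (p ^ a))%N) 'Phi_d by rewrite big_cons.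
apply: perm_big.
apply: uniq_perm; rewrite ?divisors_uniq //=.
  rewrite divisors_uniq andbT -dvdn_divisors // gtnNdvd //.
  by rewrite ltn_exp2l // prime_gt1.
move=> d; rewrite inE -!dvdn_divisors //; apply/idP/idP.
  case/orP => [/eqP->|/dvdn_trans-> //]; first exact: dvdnn.
  by rewrite expnS dvdn_mull.
case/(dvdn_pfactor _ _ pp) => m; rewrite leq_eqVlt => /predU1P[->|ma] ->.
  by rewrite eqxx.
by rewrite dvdn_exp2l ?orbT.
Qed.

(** Distinct cyclotomic polynomials share no complex root, so a primitive root of order [n] remains
    a root of the cofactor left by the other orders. *)
Lemma prod_Cyclotomic_dvd A (s : seq nat) : uniq s -> all (leq 1) s ->
  all (vanishes_at A) s -> exists C, mask_poly A = (\prod_(n <- s) 'Phi_n) * C.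
Proof.
elim: s => [|n s IH] /=; first by exists (mask_poly A); rewrite big_nil mul1r.
case/andP=> ns us /andP[n0 s0] /andP[An As].
have [C AC] := IH us s0 As.
have [z prim_z] := C_prim_root_exists n0.
have : root (map_poly intr C) z.
  have /eqP := vanishes_at_sum prim_z An; rewrite -horner_mask AC rmorphM hornerM.
  rewrite mulf_eq0 => /orP[|//]; rewrite -/(root _ z) root_prod_intr => /hasP[d ds].
  have [y prim_y] := C_prim_root_exists (allP s0 d ds).
  rewrite (Cintr_Cyclotomic prim_y) root_cyclotomic // => prim'_z.
  move: ns; have /eqP -> : n == d; last by rewrite ds.
  by rewrite eqn_dvd !(prim_order_dvd prim_z, prim_order_dvd prim'_z)
    !prim_expr_order ?eqxx.
move/(rdvdp_CyclotomicP prim_z)/(Pdiv.RingMonic.rdvdpP (Cyclotomic_monic n)) => [C' CC'].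
by exists C'; rewrite big_cons AC CC'; ring.
Qed.

(** Evaluation at 1: each cyclotomic factor contributes [p] and the mask polynomial takes the value
    [size A], so [p ^ size s] divides [size A]. *)
Lemma vanishes_at_logn A p (s : seq nat) : prime p -> A != [::] -> uniq s ->
  all (fun i => vanishes_at A (p ^ i.+1)) s -> (size s <= logn p (size A))%N.
Proof.
move=> pp A0 us As.
have p1 := prime_gt1 pp.
have [||| C AC] := @prod_Cyclotomic_dvd A (map (fun i => p ^ i.+1)%N s).
- by rewrite map_inj_uniq // => i j /eqP; rewrite eqn_exp2l // => /eqP[].
- by apply/allP => _ /mapP[i _ ->]; rewrite expn_gt0 prime_gt0.
- by apply/allP => _ /mapP[i /(allP As) ? ->].
rewrite -pfactor_dvdn ?lt0n ?size_eq0 //.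
have /(congr1 (fun q => q.[1])) := AC; rewrite hornerM.
have -> : (mask_poly A).[1] = (size A)%:R.
  rewrite /mask_poly horner_sum -sum1_size natr_sum.
  by apply: eq_bigr => a _; rewrite hornerXn expr1n.
have -> : (\prod_(n <- [seq (p ^ i.+1)%N | i <- s]) 'Phi_n).[1] = (p ^ size s)%:R.
  rewrite big_map horner_prod natrX; elim: (s) => [|i t IH]; first by rewrite big_nil.
  by rewrite big_cons IH Cyclotomic_prime_power //= exprS.
move=> E; suff : (p ^ size s %| `|(size A)%:R%R : int|)%N by rewrite natz absz_nat.
by rewrite E abszM dvdn_mulr // natz absz_nat.
Qed.

Section Arith.
Local Open Scope nat_scope.

Lemma eq_mod_mul_add l t x y n : 0 < l ->
  (l * x + t == l * y + t %[mod l * n]) = (x == y %[mod n]).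
Proof. by move=> l0; rewrite eqn_modDr -!muln_modr eqn_pmul2l. Qed.

Lemma leq_sum_mem (s : seq nat) (F : nat -> nat) x :
  x \in s -> F x <= \sum_(y <- s) F y.
Proof. by move=> xs; rewrite (big_rem x) //= leq_addr. Qed.

Lemma tile_inj N A B a a' b b' : tile N A B -> a \in A -> a' \in A ->
  b \in B -> b' \in B -> a + b = a' + b' %[mod N] -> a = a' /\ b = b'.
Proof.
have inj1 A' B' x x' y y' : tile N A' B' -> x \in A' -> x' \in A' ->
    y \in B' -> y' \in B' -> x + y = x' + y' %[mod N] -> x = x'.
  move=> t xA x'A yB' y'B' E; apply/eqP/negPn/negP => xx'.
  have x'r : x' \in rem x A' by rewrite rem_mem // eq_sym.
  have := t (x + y).
  rewrite (big_rem x) //= => H.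
  have H1 : 0 < \sum_(b <- B') (x + b == x + y %[mod N]).
    by apply: leq_trans (leq_sum_mem _ yB'); rewrite eqxx.
  have : 0 < \sum_(a <- rem x A') \sum_(b <- B') (a + b == x + y %[mod N]).
    apply: leq_trans (leq_sum_mem _ x'r).
    by apply: leq_trans (leq_sum_mem _ y'B'); rewrite E eqxx.
  by move: H H1; case: (\sum_(b <- B') _) (\sum_(a <- rem x A') _) => [|[|m]] [].
move=> t aA a'A bB b'B E; split; first exact: (inj1 A B a a' b b').
by apply: (inj1 B A b b' a a') => //; [exact: tileC|rewrite addnC E addnC].
Qed.

Lemma tile_mul_coprime k N A B : 0 < N -> 0 < k -> coprime k (size A) ->
  tile N A B -> tile N (map (muln k) A) B.
Proof.
move=> N0; elim/ltn_ind: k A => k IH A k0 kA t.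
have [k1|k1] := leqP k 1.
  have -> : k = 1 by apply/eqP; rewrite eqn_leq k1.
  by rewrite (eq_map (g := id)) ?map_id // => a; rewrite mul1n.
have pk := pdiv_prime k1; have dk := pdiv_dvd k.
have Ek : k = pdiv k * (k %/ pdiv k) by rewrite mulnC divnK.
have k'0 : 0 < k %/ pdiv k by rewrite divn_gt0 ?pdiv_gt0 // dvdn_leq.
move: kA; rewrite {1}Ek coprimeMl => /andP[kA1 kA2].
rewrite Ek (eq_map (g := muln (pdiv k) \o muln (k %/ pdiv k))); last first.
  by move=> a; rewrite /= mulnA.
rewrite map_comp; apply: tile_mul_prime => //; first by rewrite size_map.
by apply: IH => //; rewrite ltn_Pdiv // prime_gt1.
Qed.

(** Once [A] is dilated by [K], a class [K * c] can be reached only through entries of [B] divisible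
    by [K]; dividing everything by [K] gives back [A] itself, now modulo [M]. *)
Lemma tile_coprime_part M K A B : 0 < M -> 0 < K -> coprime K (size A) ->
  tile (M * K) A B -> exists B', tile M A B'.
Proof.
move=> M0 K0 KA t.
have {}t : tile (M * K) (map (muln K) A) B.
  by apply: tile_mul_coprime; rewrite ?muln_gt0 ?M0.
exists [seq b %/ K | b <- B & K %| b] => c.
rewrite -[RHS](t (K * c)) big_map; apply: eq_bigr => a _.
rewrite big_map big_filter big_mkcond; apply: eq_bigr => b _.
case: ifPn => Kb.
  by rewrite -{2}(divnK Kb) (mulnC _ K) -mulnDr (mulnC M) -!muln_modr eqn_pmul2l.
apply/esym/eqP; rewrite eqb0; apply: contra Kb => /eqP/(congr1 (modn ^~ K)).
rewrite !modn_dvdm ?dvdn_mull // -modnDml !modnMr add0n.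
by move/eqP.
Qed.

(** With [B] inside the class [j0] modulo [l], the numbers congruent to [j + j0] are reached only
    through the entries of [A] congruent to [j]; removing residues and dividing by [l] leaves a
    tiling of the smaller group. *)
Lemma tile_residue l N (A B : seq nat) j j0 : 0 < l -> j < l -> l %| N ->
  {in B, forall b, b %% l = j0} -> tile N A B ->
  tile (N %/ l) [seq a %/ l | a <- A & a %% l == j] [seq b %/ l | b <- B].
Proof.
move=> l0 jl /dvdnP[M ->] Bj; rewrite mulnC mulKn // => t c; rewrite -[RHS](t (l * c + (j + j0))).
rewrite big_map big_filter big_mkcond; apply: eq_bigr => a _.
case: eqP => aj.
  rewrite big_map; apply: eq_big_seq => b bB.
  rewrite {2}(divn_eq a l) {2}(divn_eq b l) aj (Bj b bB) addnACA -mulnDl.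
  by rewrite (mulnC _ l) eq_mod_mul_add.
apply/esym; rewrite big1_seq // => b /andP[_ bB]; apply/eqP; rewrite eqb0.
apply/eqP => /(congr1 (modn ^~ l)); rewrite !modn_dvdm ?dvdn_mulr //.
rewrite mulnC modnMDl -modnDmr (Bj b bB) => /eqP; rewrite eqn_modDr.
by rewrite (modn_small jl) => /eqP.
Qed.

End Arith.

(** At a root of unity [z] of order [n] the tiling reads [A(z) B(z) = 1 + z + ... + z^(N-1)], which
    is 0 since [z ^+ N = 1] and [z] is not 1. *)
Lemma tile_vanishes N A B n : (0 < N)%N -> tile N A B -> (1 < n)%N -> (n %| N)%N ->
  vanishes_at A n || vanishes_at B n.
Proof.
move=> N0 t n1 nN; have [z prim_z] := C_prim_root_exists (ltnW n1).
rewrite !(vanishes_atE _ prim_z) -mulf_eq0.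
have zN : z ^+ N = 1 by apply/eqP; rewrite -(prim_order_dvd prim_z).
have zE x : z ^+ x = \sum_(c < N) (x == c %[mod N])%:R * z ^+ c.
  have xN : (x %% N < N)%N by rewrite ltn_mod.
  rewrite (bigD1 (Ordinal xN)) //= modn_mod eqxx mul1r big1 => [|c cx].
    by rewrite addr0 {1}(divn_eq x N) exprD mulnC exprM zN expr1n mul1r.
  rewrite (modn_small (ltn_ord c)) -[X in X%:R]/(nat_of_bool _).
  case: eqP => [E|]; last by rewrite mul0r.
  by case/negP: cx; apply/eqP/val_inj.
have -> : (\sum_(a <- A) z ^+ a) * (\sum_(b <- B) z ^+ b) = \sum_(c < N) z ^+ c.
  rewrite mulr_suml.
  under eq_bigr => a _.
    rewrite mulr_sumr; under eq_bigr do rewrite -exprD zE.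
    rewrite exchange_big; over.
  rewrite exchange_big; apply: eq_bigr => c _ /=.
  transitivity ((\sum_(a <- A) \sum_(b <- B) (a + b == c %[mod N]))%N%:R * z ^+ c).
    rewrite natr_sum mulr_suml; apply: eq_bigr => a _.
    by rewrite natr_sum mulr_suml.
  by rewrite t mul1r.
have z1 : z - 1 != 0.
  by rewrite subr_eq0 -[z]expr1 -(prim_order_dvd prim_z) dvdn1 gtn_eqF.
by apply/eqP/(mulfI z1); rewrite -subrX1 zN subrr mulr0.
Qed.

Section PrimePower.
Variables (p : nat) (pp : prime p).

Definition vanishing_exponents A n :=
  [seq i <- iota 0 n | vanishes_at A (p ^ i.+1)].

(* Condition (T1) of Coven and Meyerowitz: the two counts are at most [logn p (size A)] and
   [logn p (size B)], while their sum is at least [logn p N]. *)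
Lemma tile_vanishing_exponents N A B : (0 < N)%N -> tile N A B ->
  size (vanishing_exponents A (logn p N)) = logn p (size A) /\
  forall i, (p ^ i.+1 %| N)%N -> vanishes_at A (p ^ i.+1) -> ~~ vanishes_at B (p ^ i.+1).
Proof.
move=> N0 t; have sAB := tile_size N0 t.
have sA0 : (0 < size A)%N by case: (size A) sAB N0 => [<-|].
have sB0 : (0 < size B)%N by move: N0; rewrite -sAB muln_gt0 => /andP[].
have le X : (0 < size X)%N ->
    (size (vanishing_exponents X (logn p N)) <= logn p (size X))%N.
  move=> X0; apply: vanishes_at_logn => //; first by rewrite -size_eq0 -lt0n.
    by rewrite filter_uniq // iota_uniq.
  by apply/allP => i; rewrite mem_filter => /andP[].
have := le A sA0; have := le B sB0.
have : (logn p (size A) + logn p (size B))%N = logn p N by rewrite -lognM // sAB.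
rewrite /vanishing_exponents !size_filter.
set a := fun i => vanishes_at A (p ^ i.+1); set b := fun i => vanishes_at B (p ^ i.+1).
have := count_predUI a b (iota 0 (logn p N)).
have -> : count (predU a b) (iota 0 (logn p N)) = logn p N.
  rewrite -[RHS](size_iota 0); apply/eqP; rewrite -all_count; apply/allP => i.
  rewrite mem_iota add0n => /andP[_ iN]; rewrite /= /a /b.
  apply: (tile_vanishes N0 t); last by rewrite pfactor_dvdn.
  by rewrite -(exp1n i.+1) ltn_exp2r // prime_gt1.
move=> E1 E2 E3 E4.
have : count (predI a b) (iota 0 (logn p N)) = 0%N /\ count a (iota 0 (logn p N)) = logn p (size A).
  have ar (x y z u v w : nat) : (w + x = y + z -> u + v = w -> z <= v -> y <= u ->
      x = 0 /\ y = u)%N by lia.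
  exact: ar E1 E2 E3 E4.
case=> E0 -> ; split=> // i iN ai; apply/negP => bi.
move/eqP: E0; rewrite eqn0Ngt -has_count; case/hasP; exists i; last by rewrite /= /a ai.
by rewrite mem_iota -pfactor_dvdn.
Qed.

End PrimePower.

(** * Sands' theorem for two primes *)

Section Sands.
Local Open Scope nat_scope.

Definition congruent_mod l (A : seq nat) : bool :=
  allrel (fun a a' => a == a' %[mod l]) A A.

Lemma congruent_modP l A : reflect {in A &, forall a a', a = a' %[mod l]} (congruent_mod l A).
Proof.
by apply: (iffP allrelP) => H a a' aA a'A; apply/eqP; apply: H.
Qed.

Lemma congruent_modPn l A : ~~ congruent_mod l A ->
  exists a a', [/\ a \in A, a' \in A & a != a' %[mod l]].
Proof.
move=> /allPn[a aA /allPn[a' a'A aa']]; by exists a, a'.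
Qed.

(** If one pair differs only modulo [p] and another, [b] and [b'], only modulo [r], some [x] of the
    first pair differs from [b] modulo [p]. Both [b] and [b'] then differ from [x] modulo [p], and
    one of them also modulo [r]. *)
Lemma incongruent_two p r A : ~~ congruent_mod p A -> ~~ congruent_mod r A ->
  exists a a', [/\ a \in A, a' \in A, a != a' %[mod p] & a != a' %[mod r]].
Proof.
move=> /congruent_modPn[a [a' [aA a'A ap]]] /congruent_modPn[b [b' [bA b'A br]]].
have [ar|ar] := boolP (a == a' %[mod r]); last by exists a, a'.
have [bp|bp] := boolP (b == b' %[mod p]); last by exists b, b'.
have [x [xA xb xa]] : exists x, [/\ x \in A, x != b %[mod p] & x == a %[mod r]].
  have [ab|ab] := boolP (a == b %[mod p]); last by exists a.
  exists a'; split=> //; last by rewrite eq_sym.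
  by apply: contra ap => /eqP ->.
have [y [yA xy yb]] : exists y, [/\ y \in A, y != x %[mod r] & y == b %[mod p]].
  have [xb'|xb'] := boolP (x == b %[mod r]).
    exists b'; split=> //; last by rewrite eq_sym.
    by rewrite -(eqP xb') in br; rewrite eq_sym.
  by exists b; split=> //; rewrite eq_sym.
by exists y, x; split=> //; rewrite (eqP yb) eq_sym.
Qed.

(** [N.-1] plays the role of -1 modulo [N], so the two sums are differences. Were both units, with
    quotient [k], the dilation of [A] by [k] would still tile, yet [k * a + b'] and [k * a' + b]
    would be the same class. Then [b = b'], and the difference 0 is not a unit. *)
Lemma tile_unit_differences N A B a a' b b' : 1 < N -> tile N A B ->
  a \in A -> a' \in A -> b \in B -> b' \in B ->
  ~~ (coprime N (a + N.-1 * a') && coprime N (b + N.-1 * b')).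
Proof.
move=> N1 t aA a'A bB b'B; apply/negP; have N0 := ltnW N1.
set u := (a + _); set v := (b + _) => /andP[uN vN].
have u0 : 0 < u by rewrite lt0n; apply: contraL uN => /eqP ->; rewrite /coprime gcdn0 gtn_eqF.
have [x y xy _] := egcdnP N u0; rewrite gcdnC (eqP uN) in xy.
pose k := x * v.
have xu : x * u = 1 %[mod N] by rewrite xy modnMDl.
have ku : k * u = v %[mod N].
  by rewrite /k mulnAC -modnMml xu modnMml mul1n.
have kN : coprime N k.
  rewrite coprimeMr vN andbT.
  have : coprime N (x * u) by rewrite -coprime_modr xu coprime_modr coprimen1.
  by rewrite coprimeMr => /andP[].
have k0 : 0 < k by rewrite lt0n; apply: contraL kN => /eqP ->; rewrite /coprime gcdn0 gtn_eqF.
have tk : tile N (map (muln k) A) B.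
  apply: tile_mul_coprime => //; rewrite coprime_sym; apply: coprime_dvdl kN.
  by rewrite -(tile_size N0 t) dvdn_mulr.
have [] := @tile_inj N _ B (k * a) (k * a') b' b tk; rewrite ?map_f //.
  apply/eqP; rewrite -(eqn_modDr (k * N.-1 * a' + N.-1 * b')).
  have -> : k * a + b' + (k * N.-1 * a' + N.-1 * b') = k * u + (1 + N.-1) * b'.
    by rewrite /u; ring.
  have -> : k * a' + b + (k * N.-1 * a' + N.-1 * b') = k * a' * (1 + N.-1) + v.
    by rewrite /v; ring.
  rewrite add1n prednK //.
  by rewrite modnMDl addnC mulnC modnMDl ku.
move=> _ E; move: vN; rewrite /v -E -mulSn prednK // -coprime_modr modnMr.
by rewrite /coprime gcdn0 gtn_eqF.
Qed.

Lemma dvdn_diff N l a a' : 0 < N -> l %| N -> l %| a + N.-1 * a' -> a == a' %[mod l].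
Proof.
move=> N0 lN; rewrite -(eqn_modDr (N.-1 * a')) -mulSn prednK // /dvdn => /eqP ->.
by rewrite eq_sym -/(dvdn _ _) dvdn_mulr.
Qed.

(* Otherwise both [A] and [B] have a difference that is a unit modulo [N], and a dilation
   of [A] by a unit makes these differences equal. *)
Lemma sands N p r A B : 1 < N -> (forall l, prime l -> l %| N -> l = p \/ l = r) ->
  tile N A B ->
  exists l, [/\ prime l, l %| N & congruent_mod l A || congruent_mod l B].
Proof.
move=> N1 prN t; have N0 := ltnW N1.
have unit_diff X : (forall l, prime l -> l %| N -> ~~ congruent_mod l X) ->
    exists a a', [/\ a \in X, a' \in X & coprime N (a + N.-1 * a')].
  move=> H.
  suff [a [a' [aX a'X aa']]] : exists a a', [/\ a \in X, a' \in X &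
      forall l, prime l -> l %| N -> a != a' %[mod l]].
    exists a, a'; split=> //; rewrite /coprime; apply/negPn/negP => g1.
    have g2 : 1 < gcdn N (a + N.-1 * a') by rewrite ltn_neqAle eq_sym g1 gcdn_gt0 N0.
    have gp := pdiv_prime g2; have := pdiv_dvd (gcdn N (a + N.-1 * a')).
    rewrite dvdn_gcd => /andP[lN la]; case/negP: (aa' _ gp lN).
    exact: dvdn_diff la.
  (* [y] may fail to be a prime divisor of [N]; then incongruence modulo [x] alone suffices. *)
  have two x y : prime x -> x %| N -> (forall l, prime l -> l %| N -> l = x \/ l = y) ->
      exists a a', [/\ a \in X, a' \in X & forall l, prime l -> l %| N -> a != a' %[mod l]].
    move=> xp xN xy; have [/andP[yp yN]|ny] := boolP (prime y && (y %| N)).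
      have [a [a' [aX a'X ax ay]]] := incongruent_two (H x xp xN) (H y yp yN).
      by exists a, a'; split=> // l lp lN; case: (xy l lp lN) => ->.
    have [a [a' [aX a'X ax]]] := congruent_modPn (H x xp xN).
    exists a, a'; split=> // l lp lN; case: (xy l lp lN) => E; rewrite E //.
    by move: ny; rewrite -E lp lN.
  have lp := pdiv_prime N1; have lN := pdiv_dvd N.
  case: (prN _ lp lN) => E; rewrite E in lp lN; first exact: (two p r).
  by apply: (two r p) => // l ? ?; rewrite or_comm; apply: prN.
case: (boolP (has (fun l => congruent_mod l A || congruent_mod l B) (primes N))).
  by case/hasP => l; rewrite mem_primes => /and3P[lp _ lN] lAB; exists l.
move/hasPn => H; exfalso.
have HAB l : prime l -> l %| N -> ~~ congruent_mod l A && ~~ congruent_mod l B.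
  by move=> lp lN; rewrite -negb_or; apply: H; rewrite mem_primes lp N0.
have [l lp lN|a [a' [aA a'A ca]]] := unit_diff A; first by case/andP: (HAB l lp lN).
have [l lp lN|b [b' [bB b'B cb]]] := unit_diff B; first by case/andP: (HAB l lp lN).
by have := tile_unit_differences N1 t aA a'A bB b'B; rewrite ca cb.
Qed.

End Sands.

(** * Condition (T2) by descent along a prime *)

Definition residue_part l j (A : seq nat) := [seq (a %/ l)%N | a <- A & (a %% l == j)%N].

Lemma sum_residue_part (F : comNzRingType) l (A : seq nat) (z : F) : (0 < l)%N ->
  \sum_(a <- A) z ^+ a
  = \sum_(j < l) z ^+ j * \sum_(x <- residue_part l j A) (z ^+ l) ^+ x.
Proof.
move=> l0; under [RHS]eq_bigr do rewrite big_map big_filter mulr_sumr big_mkcond.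
rewrite exchange_big; apply: eq_bigr => a _ /=.
have al : (a %% l < l)%N by rewrite ltn_mod.
rewrite (bigD1 (Ordinal al)) //= eqxx big1 ?addr0 => [|j ja].
  by rewrite -exprM -exprD mulnC addnC -divn_eq.
by case: ifP => // /eqP E; case/negP: ja; apply/eqP/val_inj.
Qed.

Lemma sum_congruent (F : comNzRingType) l j (A : seq nat) (z : F) :
  {in A, forall a, a %% l = j}%N ->
  \sum_(a <- A) z ^+ a = z ^+ j * \sum_(x <- [seq (a %/ l)%N | a <- A]) (z ^+ l) ^+ x.
Proof.
move=> Aj; rewrite big_map mulr_sumr; apply: eq_big_seq => a aA.
by rewrite {1}(divn_eq a l) (Aj a aA) exprD mulrC mulnC exprM.
Qed.

(** Up to the nonzero factor [z ^+ j], the sum over [A] at [z] is the sum over the quotients at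
    [z ^+ l]. The order [m] is a parameter because the descent needs both [m = n] (for [l] prime to
    [n]) and [m = n / l]. *)
Lemma vanishes_at_congruent l j A n (z : algC) : (0 < l)%N ->
  {in A, forall a, a %% l = j}%N -> forall m, n.-primitive_root z ->
  m.-primitive_root (z ^+ l) ->
  vanishes_at A n = vanishes_at [seq (a %/ l)%N | a <- A] m.
Proof.
move=> l0 Aj m zn zm; rewrite (vanishes_atE A zn) (vanishes_atE _ zm).
have z0 : z != 0.
  apply: contra_eq_neq (prim_expr_order zn) => ->.
  by rewrite expr0n gtn_eqF ?(prim_order_gt0 zn) // eq_sym oner_eq0.
by rewrite (sum_congruent z Aj) mulf_eq0 expf_eq0 (negPf z0) andbF.
Qed.

Lemma prim_root_expl (z : algC) l m : (0 < l)%N -> (l * m).-primitive_root z ->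
  m.-primitive_root (z ^+ l).
Proof.
move=> l0 zlm; have := prim_order_gt0 zlm; rewrite muln_gt0 => /andP[_ m0].
have := dvdn_prim_root zlm (dvdn_mull l (dvdnn m)).
by rewrite mulnK.
Qed.

(* Condition (T2) of Coven and Meyerowitz for two primes. *)
Definition T2_property N := forall p r A B i j, prime p -> prime r -> p != r ->
  (forall l, prime l -> l %| N -> l = p \/ l = r)%N -> tile N A B ->
  (p ^ i.+1 %| N)%N -> (r ^ j.+1 %| N)%N ->
  vanishes_at A (p ^ i.+1) -> vanishes_at A (r ^ j.+1) ->
  vanishes_at A (p ^ i.+1 * r ^ j.+1).

(** If [A] lies in one class modulo [p], its quotients tile the smaller group and the order loses
    one factor [p]. If [B] does, each residue part of [A] tiles the smaller group with the quotients
    of [B] as complement. As [A] and [B] never vanish at the same prime power order dividing [N],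
    these quotients do not vanish where needed, so every residue part does. *)
Lemma T2_step N p r A B i j : (0 < N)%N -> T2_property (N %/ p) ->
  prime p -> prime r -> p != r ->
  (forall l, prime l -> l %| N -> l = p \/ l = r)%N -> tile N A B ->
  (p ^ i.+1 %| N)%N -> (r ^ j.+1 %| N)%N ->
  vanishes_at A (p ^ i.+1) -> vanishes_at A (r ^ j.+1) ->
  congruent_mod p A || congruent_mod p B ->
  vanishes_at A (p ^ i.+1 * r ^ j.+1).
Proof.
move=> N0 IH pp rp pr prN t piN rjN pA rA.
have p0 := prime_gt0 pp.
have pN : (p %| N)%N by apply: dvdn_trans piN; rewrite expnS dvdn_mulr.
have N'0 : (0 < N %/ p)%N by rewrite divn_gt0 // dvdn_leq.
have prN' l : prime l -> (l %| N %/ p -> l = p \/ l = r)%N.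
  by move=> lp lN; apply: prN => //; apply: dvdn_trans lN _; apply: dvdn_div.
have cpr k : coprime p (r ^ k) by rewrite coprimeXr // prime_coprime // dvdn_prime2.
have rjN' : (r ^ j.+1 %| N %/ p)%N by rewrite dvdn_divRL // Gauss_dvd ?rjN // coprime_sym.
have ppow k : (0 < p ^ k)%N by rewrite expn_gt0 p0.
have rpow k : (0 < r ^ k)%N by rewrite expn_gt0 prime_gt0.
have rgt1 : (1 < r ^ j.+1)%N by rewrite -(exp1n j.+1) ltn_exp2r // prime_gt1.
have [zr prim_zr] := C_prim_root_exists (rpow j.+1).
have prim_zrp : (r ^ j.+1).-primitive_root (zr ^+ p) by rewrite prim_root_exp_coprime.
have residue X : X != [::] -> congruent_mod p X ->
    exists2 j0, (j0 < p)%N & {in X, forall a, a %% p = j0}%N.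
  case: X => // x X _ /congruent_modP H; exists (x %% p)%N; first by rewrite ltn_mod.
  by move=> a aX; apply: H; rewrite // mem_head.
have AB0 : (A != [::]) && (B != [::]).
  by rewrite -!size_eq0 -!lt0n -muln_gt0 (tile_size N0 t).
have [z prim_z] : {z : algC | (p ^ i.+1 * r ^ j.+1).-primitive_root z}.
  by apply: C_prim_root_exists; rewrite muln_gt0 ppow rpow.
have prim_zp : (p ^ i * r ^ j.+1).-primitive_root (z ^+ p).
  by apply: prim_root_expl; rewrite // mulnA -expnS.
have piN' k : i = k.+1 -> (p ^ k.+1 %| N %/ p)%N.
  by move=> E; rewrite dvdn_divRL // -expnSr -E.
case/andP: AB0 => A0 B0; case/orP => [/(residue _ A0)|/(residue _ B0)] [j0 j0p Xj0].
  have tA : tile (N %/ p) [seq (a %/ p)%N | a <- A] (residue_part p 0 B).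
    by apply: tileC; apply: (tile_residue p0 p0 pN Xj0); apply: tileC.
  rewrite (vanishes_at_congruent p0 Xj0 prim_z prim_zp).
  have rA' : vanishes_at [seq (a %/ p)%N | a <- A] (r ^ j.+1).
    by rewrite -(vanishes_at_congruent p0 Xj0 prim_zr prim_zrp).
  have [zi prim_zi] := C_prim_root_exists (ppow i.+1).
  have prim_zip : (p ^ i).-primitive_root (zi ^+ p) by apply: prim_root_expl; rewrite -?expnS.
  move: pA; rewrite (vanishes_at_congruent p0 Xj0 prim_zi prim_zip).
  (* For [i = 0] the order drops to 1, where the sum is the size of [A], not 0. *)
  case: i piN' prim_zi prim_zip {piN prim_z prim_zp} => [|i] piN' prim_zi prim_zip pA'.
    have y1 : zi ^+ p = 1 by rewrite -[LHS]expr1; apply: prim_expr_order prim_zip.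
    move: pA'; rewrite (vanishes_atE _ prim_zip) y1.
    under eq_bigr do rewrite expr1n.
    rewrite big_const_seq count_predT iter_addr_0 size_map -mulr_natl mulr1.
    by rewrite pnatr_eq0 size_eq0 (negPf A0).
  exact: (IH p r _ _ i j pp rp pr prN' tA (piN' _ erefl) rjN' pA' rA').
rewrite (vanishes_atE A prim_z) (sum_residue_part A z p0) big1 // => k _.
have tAk := tile_residue p0 (ltn_ord k) pN Xj0 t; rewrite -/(residue_part p k A) in tAk.
suff vk : vanishes_at (residue_part p k A) (p ^ i * r ^ j.+1).
  by rewrite (vanishes_at_sum prim_zp vk) mulr0.
have rAk : vanishes_at (residue_part p k A) (r ^ j.+1).
  have /orP[//|] := tile_vanishes N'0 tAk rgt1 rjN'.
  rewrite -(vanishes_at_congruent p0 Xj0 prim_zr prim_zrp) => rB.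
  by have [_ /(_ j rjN rA)] := tile_vanishing_exponents rp N0 t; rewrite rB.
case: i piN' piN pA {prim_z prim_zp} => [|i] piN' piN pA; first by rewrite mul1n.
apply: (IH p r _ _ i j pp rp pr prN' tAk (piN' _ erefl) rjN' _ rAk).
have pgt1 : (1 < p ^ i.+1)%N by rewrite -(exp1n i.+1) ltn_exp2r // prime_gt1.
have /orP[//|] := tile_vanishes N'0 tAk pgt1 (piN' _ erefl).
have [zi prim_zi] := C_prim_root_exists (ppow i.+2).
have prim_zip : (p ^ i.+1).-primitive_root (zi ^+ p) by apply: prim_root_expl; rewrite -?expnS.
rewrite -(vanishes_at_congruent p0 Xj0 prim_zi prim_zip) => pB.
by have [_ /(_ i.+1 piN pA)] := tile_vanishing_exponents pp N0 t; rewrite pB.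
Qed.

Lemma tile_T2 N : (0 < N)%N -> T2_property N.
Proof.
elim/ltn_ind: N => N IH N0 p r A B i j pp rp pr prN t piN rjN pA rA.
have pN : (p %| N)%N by apply: dvdn_trans piN; rewrite expnS dvdn_mulr.
have rN : (r %| N)%N by apply: dvdn_trans rjN; rewrite expnS dvdn_mulr.
have N1 : (1 < N)%N by apply: leq_trans (prime_gt1 pp) (dvdn_leq N0 pN).
have IH' l : prime l -> (l %| N)%N -> T2_property (N %/ l).
  move=> lp lN; apply: IH; first by rewrite ltn_Pdiv ?prime_gt1.
  by rewrite divn_gt0 ?prime_gt0 // dvdn_leq.
have [l [lp lN lAB]] := sands N1 prN t.
case: (prN l lp lN) => E; rewrite E in lp lN lAB.
  exact: (T2_step N0 (IH' p pp pN) pp rp pr prN t).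
rewrite mulnC; apply: (T2_step N0 (IH' r rp rN) rp pp _ _ t) => //; first by rewrite eq_sym.
by move=> k kp kN; rewrite or_comm; apply: prN.
Qed.

(** * Digit expansions and the spectrum of a tile *)

Lemma eq_digit p k k' (m : int) : (k < p)%N -> (k' < p)%N ->
  k%:Z - k'%:Z = m * p%:Z -> k = k' /\ m = 0.
Proof.
move=> kp k'p E.
have [m1|[m0|m1]] : m <= -1 \/ m = 0 \/ 1 <= m by lia.
- by have : m * p%:Z <= - p%:Z; [rewrite -mulN1r ler_wpM2r|lia].
- by split=> //; move: E; rewrite m0; lia.
- by have : p%:Z <= m * p%:Z; [rewrite ler_peMl|lia].
Qed.

(* Among [n] digits, the one of weight [p ^ (n - 1 - j)] is free if [Q j] and zero otherwise. *)
Fixpoint digit_set (p : nat) (Q : pred nat) (n : nat) : seq int :=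
  if n is m.+1 then
    [seq p%:Z * x + k%:Z | x <- digit_set p Q m, k <- if Q m then iota 0 p else [:: 0%N]]
  else [:: 0].

Lemma digit_setS p Q n : digit_set p Q n.+1 =
  [seq p%:Z * x + k%:Z | x <- digit_set p Q n, k <- if Q n then iota 0 p else [:: 0%N]].
Proof. by []. Qed.

Lemma size_digit_set p Q n : size (digit_set p Q n) = (p ^ count Q (iota 0 n))%N.
Proof.
elim: n => // n IH; rewrite digit_setS size_allpairs IH -(addn1 n) iotaD count_cat /= addn0.
by case: (Q n); rewrite ?size_iota /= ?addn0 ?muln1 // addn1 expnSr.
Qed.

(** [j] is the least significant place where the expansions differ. The weight [p ^ (n - 1 - j)] is
    the exact power of [p] in [x - x'], so [(x - x') / p ^ n] has reduced denominator [p ^ j.+1];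
    [Q j] holds because only free digits can differ. *)
Lemma digit_set_sub p Q n x x' : prime p ->
  x \in digit_set p Q n -> x' \in digit_set p Q n -> x != x' ->
  exists j u, [/\ (j < n)%N, Q j, ~~ (p%:Z %| u)%Z & (x - x') * (p ^ j.+1)%:Z = (p ^ n)%:Z * u].
Proof.
move=> pp; elim: n x x' => [|n IH] x x'; first by rewrite !inE => /eqP-> /eqP->; rewrite eqxx.
rewrite digit_setS => /allpairsP[[y k] [/= yE kE ->]] /allpairsP[[y' k'] [/= y'E k'E ->]] ne.
have [kk'|kk'] := eqVneq k k'.
  have yy' : y != y' by apply: contra ne => /eqP ->; rewrite kk'.
  have [j [u [jn Qj pu E]]] := IH y y' yE y'E yy'.
  exists j, u; split=> //; first exact: ltnW.
  rewrite kk' [(p ^ n.+1)%N]expnS PoszM -mulrA -E; ring.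
have Qn : Q n by move: kE k'E kk'; case: ifP => //; rewrite !inE => _ /eqP-> /eqP->.
move: kE k'E; rewrite Qn !mem_iota !add0n !leq0n /= => kp k'p.
exists n, (p%:Z * y + k%:Z - (p%:Z * y' + k'%:Z)); split=> //; last by rewrite mulrC.
apply/negP => /dvdzP[q Eq]; have : k%:Z - k'%:Z = (q - y + y') * p%:Z.
  by rewrite mulrDl mulrBl -Eq; ring.
by case/(eq_digit kp k'p) => E _; rewrite E eqxx in kk'.
Qed.

Lemma digit_set_uniq p Q n : prime p -> uniq (digit_set p Q n).
Proof.
move=> pp; elim: n => // n IH; rewrite digit_setS; apply: allpairs_uniq => //.
  by case: ifP => // _; apply: iota_uniq.
have p0 := prime_gt0 pp.
move=> [? ?] [? ?] /allpairsP[[y k] [/= yE kE [-> ->]]] /allpairsP[[y' k'] [/= y'E k'E [-> ->]]] E.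
have [kp k'p] : (k < p)%N /\ (k' < p)%N.
  move: kE k'E; case: ifP => _; rewrite !(mem_iota, inE, add0n, leq0n) /=.
    by [].

  by move=> /eqP-> /eqP->.
have [|-> /eqP] := @eq_digit p k k' (y' - y) kp k'p.
  by rewrite mulrBl; move: E => /= E; lia.
by rewrite subr_eq0 => /eqP->.
Qed.

Lemma prime_ndvdz_coprime p n (u : int) : prime p -> ~~ (p%:Z %| u)%Z -> coprimez u (p ^ n)%:Z.
Proof.
move=> pp pu; rewrite /coprimez /gcdz absz_nat eqz_nat -/(coprime _ _) coprimeXr //.
by rewrite coprime_sym prime_coprime.
Qed.

(* [u / n] is the reduced form of [(s - s') / N]. *)
Lemma tile_spectrum p r a b A B : prime p -> prime r -> p != r ->
  tile (p ^ a * r ^ b) A B ->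
  exists S : seq int, [/\ uniq S, size S = size A &
    {in S &, forall s s', s != s' -> exists n u,
      [/\ (0 < n)%N, coprimez u n%:Z, (s - s') * n%:Z = u * (p ^ a * r ^ b)%:Z
         & vanishes_at A n]}].
Proof.
move=> pp rp pr t; set N := (p ^ a * r ^ b)%N in t *.
have p0 := prime_gt0 pp; have r0 := prime_gt0 rp.
have ppow k : (0 < p ^ k)%N by rewrite expn_gt0 p0.
have rpow k : (0 < r ^ k)%N by rewrite expn_gt0 r0.
have N0 : (0 < N)%N by rewrite muln_gt0 ppow rpow.
have pra : coprime p r by rewrite prime_coprime // dvdn_prime2.
have Np : logn p N = a.
  by rewrite lognM // pfactorK // (@logn_coprime p (r ^ b)) ?addn0 ?coprimeXr.
have Nr : logn r N = b.
  by rewrite lognM // pfactorK // (@logn_coprime r (p ^ a)) // coprimeXr // coprime_sym.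
have prN l : prime l -> (l %| N)%N -> l = p \/ l = r.
  move=> lp; rewrite Euclid_dvdM // !Euclid_dvdX // => /orP[/andP[H _]|/andP[H _]].
    by left; apply/eqP; rewrite -dvdn_prime2.
  by right; apply/eqP; rewrite -dvdn_prime2.
pose Qp j := vanishes_at A (p ^ j.+1); pose Qr j := vanishes_at A (r ^ j.+1).
pose Xp := digit_set p Qp a; pose Xr := digit_set r Qr b.
have ndiv (l q : nat) (u v : int) k : prime l -> prime q -> l != q -> ~~ (l%:Z %| u)%Z ->
    ~~ (l%:Z %| u * (q ^ k)%:Z + v * l%:Z)%Z.
  move=> lp qp lq lu; rewrite rpredDr; last exact: dvdz_mull.
  rewrite -[X in ~~ X]/(l%:Z %| u * (q ^ k)%:Z)%Z Gauss_dvdzl // /coprimez /gcdz absz_nat eqz_nat -/(coprime _ _) coprimeXr //.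
  by rewrite prime_coprime // dvdn_prime2.
have key x x' y y' : x \in Xp -> x' \in Xp -> y \in Xr -> y' \in Xr ->
    (x != x') || (y != y') -> exists n u,
      [/\ (1 < n)%N, coprimez u n%:Z, (x * (r ^ b)%:Z + y * (p ^ a)%:Z
         - (x' * (r ^ b)%:Z + y' * (p ^ a)%:Z)) * n%:Z = u * N%:Z
         & vanishes_at A n].
  move=> xX x'X yX y'X.
  have gt1 (l k : nat) : prime l -> (1 < l ^ k.+1)%N.
    by move=> lp; rewrite -(exp1n k.+1) ltn_exp2r // prime_gt1.
  have dvN (c d e : nat) : (d < c)%N -> (e ^ d.+1 %| e ^ c)%N by move=> dc; apply: dvdn_exp2l.
  have [<-|xx'] := eqVneq x x'; have [<-|yy'] := eqVneq y y' => // _.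
  - have [j [u [jb Qj ru E]]] := digit_set_sub rp yX y'X yy'.
    exists (r ^ j.+1)%N, u; split; [exact: gt1|exact: prime_ndvdz_coprime| |exact: Qj].
    rewrite /N PoszM; transitivity ((y - y') * (r ^ j.+1)%:Z * (p ^ a)%:Z); first by ring.
    by rewrite E; ring.
  - have [j [u [jb Qj ru E]]] := digit_set_sub pp xX x'X xx'.
    exists (p ^ j.+1)%N, u; split; [exact: gt1|exact: prime_ndvdz_coprime| |exact: Qj].
    rewrite /N PoszM; transitivity ((x - x') * (p ^ j.+1)%:Z * (r ^ b)%:Z); first by ring.
    by rewrite E; ring.
  (* Both components differ: the reduced denominators are coprime, so they multiply, and (T2) gives
     vanishing at the product. *)
  have [j [u [ja Qj pu E]]] := digit_set_sub pp xX x'X xx'.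
  have [k [v [kb Qk rv E']]] := digit_set_sub rp yX y'X yy'.
  exists (p ^ j.+1 * r ^ k.+1)%N, (u * (r ^ k.+1)%:Z + v * (p ^ j.+1)%:Z).
  have powS (q e : nat) : (q ^ e.+1)%:Z = (q ^ e)%:Z * q%:Z by rewrite expnSr PoszM.
  split.
  - by rewrite (leq_trans (gt1 p j pp)) // leq_pmulr ?rpow //.
  - rewrite PoszM coprimezMr; apply/andP; split; apply: prime_ndvdz_coprime => //.
      by rewrite (powS p j) mulrA; apply: ndiv.
    by rewrite addrC (powS r k) mulrA; apply: ndiv; rewrite // eq_sym.
  - rewrite /N !PoszM.
    transitivity (((x - x') * (p ^ j.+1)%:Z) * (r ^ b)%:Z * (r ^ k.+1)%:Z
      + ((y - y') * (r ^ k.+1)%:Z) * (p ^ a)%:Z * (p ^ j.+1)%:Z); first by ring.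
    by rewrite E E'; ring.
  apply: (tile_T2 N0 pp rp pr prN t) => //.
    by rewrite /N dvdn_mulr // dvN.
  by rewrite /N dvdn_mull // dvN.
exists [seq x * (r ^ b)%:Z + y * (p ^ a)%:Z | x <- Xp, y <- Xr]; split.
- apply: allpairs_uniq; [exact: digit_set_uniq|exact: digit_set_uniq|].
  move=> [x y] [x' y'] /allpairsP[[? ?] [/= xE yE [-> ->]]] /allpairsP[[? ?] [/= x'E y'E [-> ->]]] E.
  apply/eqP; rewrite -[_ == _]negbK; apply/negP; rewrite xpair_eqE negb_and => ne.
  (* Equal sums would make [u = 0], which is not coprime to [n > 1]. *)
  have [n [u [n1 un]]] := key _ _ _ _ xE x'E yE y'E ne.
  rewrite E subrr mul0r => /esym/eqP; rewrite mulf_eq0 eqz_nat (gtn_eqF N0) orbF => /eqP u0.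
  by move: un; rewrite u0 /coprimez gcd0z eqz_nat /= gtn_eqF.
- rewrite size_allpairs !size_digit_set.
  (* By (T1) the numbers of free digits are [logn p (size A)] and [logn r (size A)], and [size A]
     divides [N], which has no other prime factor. *)
  have [+ _] := tile_vanishing_exponents pp N0 t; rewrite size_filter Np => ->.
  have [+ _] := tile_vanishing_exponents rp N0 t; rewrite size_filter Nr => ->.
  have sA := tile_size N0 t.
  have sA0 : (0 < size A)%N by case: (size A) sA N0 => [<-|].
  have lA l : prime l -> l != p -> l != r -> logn l (size A) = 0%N.
    move=> lp lnp lnr; apply/eqP; rewrite lognE lp sA0 /=; case: ifP => // lA.
    have : (l %| N)%N by rewrite -sA dvdn_mulr.
    by case/(prN l lp) => E; move: lnp lnr; rewrite E eqxx.
  apply: eqn_from_log => //; first by rewrite muln_gt0 ppow rpow.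
  move=> l /=; rewrite lognM //.
  have [->|lp] := eqVneq l p.
    by rewrite pfactorK // (@logn_coprime p (r ^ _)) ?addn0 ?coprimeXr.
  have [->|lr] := eqVneq l r.
    by rewrite pfactorK // (@logn_coprime r (p ^ _)) // coprimeXr // coprime_sym.
  have [lP|/negPf nl] := boolP (prime l); last first.
    have l0 m : logn l m = 0%N by rewrite lognE nl.
    by rewrite !l0.
  rewrite (lA l) // !lognX (logn_prime _ pp) (logn_prime _ rp) (negPf lp) (negPf lr).
  by rewrite !muln0.
move=> _ _ /allpairsP[[x y] [/= xE yE ->]] /allpairsP[[x' y'] [/= x'E y'E ->]] ne.
have [|n [u [n1 un E v]]] := key _ _ _ _ xE x'E yE y'E.
  by rewrite -negb_and; apply: contra ne => /andP[/eqP-> /eqP->].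
by exists n, u; split=> //; apply: ltnW.
Qed.

Local Open Scope classical_set_scope.
Local Open Scope ring_scope.

(** * Compatible pairs *)

Section Exponential.
Context {R : realType}.
Local Notation e2pi := (@e2pi R).

Lemma e2piD t t' : e2pi (t + t') = e2pi t * e2pi t'.
Proof.
rewrite /e2pi mulrDr cosD sinD; apply/eqP; rewrite eq_complex /= eqxx /=.
by apply/eqP; ring.
Qed.

Lemma e2pi0 : e2pi 0 = 1.
Proof. by rewrite /e2pi mulr0 cos0 sin0. Qed.

Lemma e2piN t : e2pi (- t) = conjc (e2pi t).
Proof. by rewrite /e2pi mulrN cosN sinN. Qed.

Lemma e2pi_nat n : e2pi n%:R = 1.
Proof.
elim: n => [|n IH]; first exact: e2pi0.
rewrite -addn1 natrD e2piD IH mul1r /e2pi mulr1 mulr_natl cos2pi.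
by rewrite mulr2n sinD sinpi mulr0 mul0r addr0.
Qed.

Lemma e2pi_int (k : int) : e2pi k%:~R = 1.
Proof.
case: k => n; first by rewrite -pmulrn e2pi_nat.
by rewrite NegzE mulrNz e2piN -pmulrn e2pi_nat conjc1.
Qed.

Lemma e2piX t n : e2pi t ^+ n = e2pi (n%:R * t).
Proof.
elim: n => [|n IH]; first by rewrite mul0r e2pi0 expr0.
by rewrite exprS IH -e2piD -{1}[t]mul1r -mulrDl -natr1 addrC.
Qed.

(** The fractional part [x] of [t] has [cos (2 pi x) = 1], hence [sin (pi x) = 0], while the sine is
    positive strictly between 0 and [pi]. *)
Lemma e2pi_eq1 t : e2pi t = 1 -> exists k : int, t = k%:~R.
Proof.
move=> et; exists (Num.floor t); apply/eqP; rewrite -subr_eq0.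
set x := t - _; have ex : e2pi x = 1 by rewrite /x e2piD -mulrNz e2pi_int mulr1.
have x0 : 0 <= x by rewrite subr_ge0 floor_le_tmp.
have x1 : x < 1 by have := lt_succ_floor t; rewrite intrD /x; lra.
have [//|xpos] := eqVneq x 0; exfalso.
have : sin (pi * x) != 0.
  have xp : 0 < x by rewrite lt_neqAle eq_sym xpos x0.
  rewrite gt_eqF //; apply: sin_gt0_pi; rewrite mulr_gt0 ?pi_gt0 //=.
  by have := pi_gt0 R; nra.
have := congr1 (@complex.Re R) ex; rewrite /e2pi /=.
have -> : 2 * pi * x = pi * x *+ 2 by rewrite mulr2n; ring.
rewrite cos_mulr2n => E sx; move/eqP: sx; apply.
have := cos2Dsin2 (pi * x); move: E; rewrite -mulr_natl => E E2.
by apply/eqP; rewrite -sqrf_eq0; apply/eqP; lra.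
Qed.

End Exponential.

Definition residues (N : int) (D : {fset int}) : seq nat :=
  [seq `|(d %% N)%Z|%N | d <- D].

Lemma residue_mod (N : int) (x : int) : N != 0 -> (`|(x %% N)%Z|%N%:Z = x %[mod N])%Z.
Proof. by move=> N0; rewrite gez0_abs ?modz_ge0 // modz_mod. Qed.

(** [E] is an arbitrary set of integers, so the list [B] collects the residues in [[0, |N|)] that it
    meets. The unique representative [s] of a class, with its unique decomposition, leaves a single
    pair of residues for that class. *)
Lemma complementing_tile (N : int) (D : {fset int}) : N != 0 ->
  complementing N [set` D] -> exists B, tile `|N|%N (residues N D) B.
Proof.
move=> N0 [E [dsum res]].
have n0 : (0 < `|N|)%N by rewrite absz_gt0.
have eqmod (x y : nat) : (x == y %[mod `|N|])%N = (x%:Z == y%:Z %[mod N])%Z.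
  by rewrite -!(modz_abs _ N) !modz_nat.
pose B := [seq j <- iota 0 `|N| | `[< exists2 e, E e & (j%:Z = e %[mod N])%Z >]].
exists B => c.
have [s [[[d dD [e eE des]] sc] suniq]] := res c%:Z.
pose r (x : int) := `|(x %% N)%Z|%N.
have rE x : ((r x)%:Z = x %[mod N])%Z by apply: residue_mod.
have addmod (x x' y y' : int) : (x = x' %[mod N] -> y = y' %[mod N] ->
    x + y = x' + y' %[mod N])%Z.
  by move=> xx' yy'; rewrite -modzDml xx' modzDml -modzDmr yy' modzDmr.
have rn x : (r x < `|N|)%N.
  by rewrite -ltz_nat /r (gez0_abs (modz_ge0 _ N0)) abszE ltz_mod.
have uA : uniq (residues N D).
  rewrite map_inj_in_uniq ?fset_uniq // => x y xD yD xy.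
  have {}xy : (x = y %[mod N])%Z by rewrite -[LHS]rE -[RHS]rE /r xy.
  (* Two congruent digits [x], [y] would give two representatives [x + e], [y + e] of one class. *)
  have [t [_ tuniq]] := res (x + e).
  have H (u : int) : u \in D -> (u = x %[mod N])%Z -> t = u + e.
    move=> uD ux; apply: tuniq; split; first by exists u => //; exists e.
    by rewrite -modzDml ux modzDml.
  have := dsum x y e e xD yD eE eE.
  by rewrite -(H x xD erefl) -(H y yD (esym xy)) => /(_ erefl)[].
have uB : uniq B by rewrite filter_uniq ?iota_uniq.
have dA : r d \in residues N D by apply: map_f.
have eB : r e \in B.
  by rewrite mem_filter mem_iota leq0n add0n rn !andbT; apply/asboolP; exists e.
have key a b : a \in residues N D -> b \in B -> (a + b = c %[mod `|N|])%N -> a = r d /\ b = r e.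
  case/mapP=> d' d'D ->; rewrite mem_filter mem_iota => /andP[/asboolP[e' e'E be'] /andP[_ bn]].
  move=> /eqP; rewrite eqmod PoszD => /eqP H.
  have H' : (d' + e' = c %[mod N])%Z.
    exact: etrans (addmod _ _ _ _ (esym (rE d')) (esym be')) H.
  have ss' : s = d' + e'.
    by apply: suniq; split=> //; exists d' => //; exists e'.
  have [E1 E2] := dsum d d' e e' dD d'D eE e'E (etrans des ss').
  split; first by rewrite E1.
  by rewrite /r E2 -be' -modz_abs modz_nat absz_nat modn_small // -(add0n `|N|%N).
rewrite (bigD1_seq (r d)) //= [X in (_ + X)%N]big1_seq ?addn0; last first.
  move=> a /andP[ad aA]; rewrite big1_seq // => b /andP[_ bB].
  apply/eqP; rewrite eqb0; apply: contra ad => /eqP.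
  by case/(key _ _ aA bB) => ->.
rewrite (bigD1_seq (r e)) //= [X in (_ + X)%N]big1_seq ?addn0; last first.
  move=> b /andP[be bB]; apply/eqP; rewrite eqb0; apply: contra be => /eqP.
  by case/(key _ _ dA bB) => _ ->.
suff -> : (r d + r e == c %[mod `|N|])%N by [].
by rewrite eqmod PoszD (addmod _ _ _ _ (rE d) (rE e)) des sc.
Qed.

Lemma two_primes_cover n : (size (primes n) <= 2)%N -> exists p r,
  [/\ prime p, prime r, p != r & forall l, l \in primes n -> l = p \/ l = r].
Proof.
have pP l : l \in primes n -> prime l by rewrite mem_primes => /and3P[].
have un := primes_uniq n.
case: (primes n) pP un => [|p [|r [|]]] //= pP un _.
(* 2 and 3 only pad the pair when fewer than two primes occur. *)
- by exists 2%N, 3%N.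
- have pp : prime p by apply: pP; rewrite inE.
  have [->|p2] := eqVneq p 2%N; first by exists 2%N, 3%N; split=> // l; rewrite inE => /eqP; left.
  by exists p, 2%N; split=> // l; rewrite inE => /eqP; left.
- exists p, r; split.
  + by apply: pP; rewrite inE eqxx.
  + by apply: pP; rewrite !inE eqxx orbT.
  + by move: un; rewrite inE andbT.
  + by move=> l; rewrite !inE => /orP[/eqP|/eqP]; [left|right].
Qed.

Lemma two_primes_part n m p r : prime p -> prime r -> p != r -> (0 < n)%N ->
  (0 < m)%N -> (forall l, l \in primes m -> l = p \/ l = r) ->
  exists a b K, n = (p ^ a * r ^ b * K)%N /\ coprime K m.
Proof.
move=> pp rp pr n0 m0 mpr.
have [n1 pn1 En] := pfactor_coprime pp n0.
have n10 : (0 < n1)%N by move: n0; rewrite En muln_gt0 => /andP[].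
have [K rK En1] := pfactor_coprime rp n10.
exists (logn p n), (logn r n1), K; split; first by rewrite {1}En {1}En1; ring.
rewrite /coprime; apply/negPn/negP => g1.
have g2 : (1 < gcdn K m)%N by rewrite ltn_neqAle eq_sym g1 gcdn_gt0 m0 orbT.
have gp := pdiv_prime g2; have := pdiv_dvd (gcdn K m).
rewrite dvdn_gcd => /andP[lK lm].
have /mpr[E|E] : pdiv (gcdn K m) \in primes m by rewrite mem_primes gp m0.
- move: pn1; rewrite prime_coprime // => /negP; apply; rewrite En1 dvdn_mulr //.
  by rewrite -E.
- by move: rK; rewrite prime_coprime // => /negP; apply; rewrite -E.
Qed.

Section CompatiblePair.
Context {R : realType}.
Local Notation e2pi := (@e2pi R).

Lemma e2pi_prim_root (n : nat) (u : int) : (0 < n)%N -> coprimez u n ->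
  n.-primitive_root (e2pi (u%:~R / n%:R)).
Proof.
move=> n0 un; have nn0 : n%:R != 0 :> R by rewrite pnatr_eq0 -lt0n.
have [|m zm mn] := @prim_order_exists _ n (e2pi (u%:~R / n%:R)) n0.
  by rewrite e2piX mulrC divfK // e2pi_int.
suff mnE : m = n by rewrite -{1}mnE.
apply/eqP;
rewrite eqn_dvd mn /=; have := prim_expr_order zm; rewrite e2piX => /e2pi_eq1[k].
move/(congr1 (fun x => x * n%:R)); rewrite -mulrA divfK // !pmulrn -!intrM => /intr_inj E.
rewrite -[n]absz_nat -[m]absz_nat -dvdzE -(@Gauss_dvdzl n%:Z m%:Z u).
  by rewrite E dvdz_mull.
by rewrite coprimez_sym.
Qed.

Lemma complementing_compatible (N : int) (D : {fset int}) : 1 < `|N| ->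
  complementing N [set` D] -> (size (primes #|` D|%fset) <= 2)%N ->
  exists S : seq int, [/\ uniq S, size S = #|` D|%fset &
    {in S &, forall s s', s != s' ->
      \sum_(d <- D) e2pi (d%:~R * ((s - s')%:~R / N%:~R)) = 0}].
Proof.
move=> N1 cND D2.
have N0 : N != 0 by rewrite -normr_gt0 (lt_trans _ N1).
have n0 : (0 < `|N|)%N by rewrite absz_gt0.
have NR0 : N%:~R != 0 :> R by rewrite intr_eq0.
have [B0 t0] := complementing_tile N0 cND.
have sA : size (residues N D) = #|` D|%fset by rewrite size_map.
have D0 : (0 < #|` D|)%N.
  by move: (tile_size n0 t0); rewrite sA; case: #|` D|%fset n0 => // n0 E; rewrite -E in n0.
have [p [r [pp rp pr cov]]] := two_primes_cover D2.
have [a [b [K [En KD]]]] := two_primes_part pp rp pr n0 D0 cov.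
set M := (p ^ a * r ^ b)%N in En.
have [M0 K0] : (0 < M)%N /\ (0 < K)%N by apply/andP; rewrite -muln_gt0 -En.
rewrite En in t0; rewrite -sA in KD.
have [B t] := tile_coprime_part M0 K0 KD t0.
have [S [uS sS spec]] := tile_spectrum pp rp pr t.
have [c Ec] : exists c, N = c * M%:Z.
  by apply/dvdzP; rewrite dvdzE En dvdn_mulr.
have c0 : c != 0 by apply: contra_neq N0 => c0; rewrite Ec c0 mul0r.
(* Since [N = c * M], the fraction [c * s / N] is [s / M]; [c] also absorbs the sign of [N]. *)
exists (map (fun s => c * s) S); split.
- by rewrite map_inj_uniq //; apply: mulfI.
- by rewrite size_map sS.
move=> _ _ /mapP[s sS' ->] /mapP[s' s'S' ->] ne.
have [|n [u [n1 un E v]]] := spec s s' sS' s'S'; first by apply: contra ne => /eqP ->.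
have nn0 : n%:R != 0 :> R by rewrite pnatr_eq0 -lt0n.
set z := c * s - c * s'.
have zN : z%:~R / N%:~R = u%:~R / n%:R :> R.
  apply/eqP; rewrite eqr_div // pmulrn -!intrM; apply/eqP; congr _%:~R.
  by rewrite /z -mulrBr -mulrA E Ec mulrCA.
rewrite -[RHS](vanishes_at_sum (e2pi_prim_root n1 un) v) big_map.
(* [N * (u / n)] is the integer [z], so the exponentials see [d] only modulo [N]. *)
apply: eq_bigr => d _; rewrite e2piX {1}(divz_eq d N) intrD mulrDl e2piD -zN.
rewrite intrM -mulrA (mulrC N%:~R) divfK // -intrM e2pi_int mul1r.
by congr (e2pi (_ * _)); rewrite [RHS]pmulrn gez0_abs ?modz_ge0.
Qed.

End CompatiblePair.

(** * Frequencies of a refinement equation *)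

Section Refinement.
Context {R : realType}.
Variables (N : int) (w M : R -> R) (S : seq int).
Hypothesis N1 : 1 < `|N|.
Hypothesis w_cont : continuous w.
Hypothesis w0 : w 0 = 1.
Hypothesis w_ge0 : forall x, 0 <= w x.
Hypothesis M_ge0 : forall x, 0 <= M x.
Hypothesis w_refine : forall x, w x = M (x / N%:~R) * w (x / N%:~R).
Hypothesis M_periodic : forall (x : R) (k : int), M (x + k%:~R) = M x.
Hypothesis M_sum : forall x : R, \sum_(s <- S) M ((x + s%:~R) / N%:~R) = 1.
Hypothesis S_uniq : uniq S.
Hypothesis M_orth : {in S &, forall s s', s != s' -> M ((s - s')%:~R / N%:~R) = 0}.
Local Notation nu := (N%:~R : R).

Let nu_gt1 : 1 < `|nu|.
Proof. by rewrite -intr_norm ltr1z. Qed.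
Let nu0 : nu != 0.
Proof. by rewrite -normr_gt0 (lt_trans _ nu_gt1). Qed.

(** [M x] is one of the nonnegative terms of [M_sum] at [x * nu - s]. *)
Let M_le1 x : M x <= 1.
Proof.
have : S != [::].
  apply/eqP => S0; have := M_sum 0; rewrite S0 big_nil => /eqP.
  by rewrite eq_sym oner_eq0.
case ES : S => [//|s S'] _.
rewrite -(M_sum (x * nu - s%:~R)) ES big_cons subrK mulfK //.
by rewrite lerDl sumr_ge0.
Qed.

Lemma w_refine_iter n x : w x = (\prod_(k < n) M (x / nu ^+ k.+1)) * w (x / nu ^+ n).
Proof.
elim: n => [|n IH]; first by rewrite big_ord0 mul1r expr0 divr1.
rewrite big_ord_recr /= {1}IH (w_refine (x / nu ^+ n)) exprSr invfM !mulrA.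
by congr (_ * M _ * w _); rewrite -!mulrA [nu^-1 * _]mulrC.
Qed.

Definition fractional (x : R) : R := x - (Num.floor x)%:~R.

Lemma fractional_itv x : 0 <= fractional x < 1.
Proof.
rewrite /fractional subr_ge0 floor_le_tmp /=.
by have := lt_succ_floor x; rewrite intrD; lra.
Qed.

Section PeriodicZeros.
Hypothesis M_eq1 : forall x, M x = 1 -> exists k : int, x = k%:~R.
Hypothesis M_zeros : finite_set [set x | -1 < x < 1 /\ M x = 0].

Let Z := [set x : R | 0 <= x < 1 /\ forall k : int, w (x + k%:~R) = 0].

Lemma expr_nu_big (d : R) : 0 < d -> exists n, `|nu ^+ n|^-1 < d.
Proof.
move=> d0; exists (Num.truncn d^-1).+1; set n := _.+1.
have nE : `|nu ^+ n| = (`|N| ^ n)%N%:R.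
  by rewrite normrX -intr_norm -abszE natrX.
have n0 : (0 < `|N| ^ n)%N.
  by rewrite expn_gt0 absz_gt0; move: nu0; rewrite intr_eq0 => ->.
rewrite nE invf_plt ?posrE ?ltr0n //.
apply: lt_le_trans (truncnS_gt _) _.
by rewrite ler_nat ltnW // ltn_expl.
Qed.

(** [w] is nonzero near 0, and one [n] brings [x / nu ^+ n] that close to 0 for all [x] in [0, 1). A
    zero of [w] there comes from one of the [n] factors [M (x / nu ^+ k.+1)], each with finitely
    many zeros. *)
Lemma periodic_zeros_finite : finite_set Z.
Proof.
have [d d0 wd] : exists2 d, 0 < d & forall y, `|y| < d -> w y != 0.
  have : \forall y \near 0, w y != 0.
    have := @w_cont 0 => /cvgr_neq0; apply.
    by rewrite w0 oner_neq0.
  by move=> /nbhs_ballP[d /= d0 H]; exists d => // y yd; apply: H; rewrite /ball /= sub0r normrN.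
have [n nd] := expr_nu_big d0.
pose F k := [set x : R | 0 <= x < 1 /\ M (x / nu ^+ k.+1) = 0].
have Ffin k : finite_set (F k).
  apply: (@sub_finite_set _ _ ((fun y => y * nu ^+ k.+1) @` [set x | -1 < x < 1 /\ M x = 0])).
    move=> x [/andP[x0 x1] Mx]; exists (x / nu ^+ k.+1); last by rewrite divfK ?expf_neq0.
    split=> //; rewrite -ltr_norml normrM normfV normrX ger0_norm //.
    rewrite ltr_pdivrMr ?exprn_gt0 ?normr_gt0 // mul1r (lt_trans x1) //.
    by rewrite exprn_egt1.
  exact: finite_image.
apply: (@sub_finite_set _ _ (\bigcup_(k in `I_n) F k)); last exact: bigcup_finite.
move=> x [/[dup] x01 /andP[x0 x1] /(_ 0)]; rewrite addr0 (w_refine_iter n) => /eqP.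
rewrite mulf_eq0 => /orP[|].
  by rewrite prodf_seq_eq0 => /hasP[k _ /= /eqP Mk]; exists k => //=.
rewrite (negPf (wd _ _)) // normrM normfV (le_lt_trans _ nd) //.
by rewrite ler_piMl ?invr_ge0 // ger0_norm // ltW.
Qed.

(* The nonzero terms of [sum_(y in Z, s in S) M ((y + s) / N) = #|Z|] sit at distinct points of
   [Z] modulo 1, which forces [M = 1] on [Z]. *)
Lemma no_periodic_zero x : exists k : int, w (x + k%:~R) != 0.
Proof.
apply: contrapT => /forallNP wx.
have Zx : Z (fractional x).
  split=> [|k]; first exact: fractional_itv.
  have /negP/negPn/eqP := wx (k - Num.floor x).
  by rewrite intrD mulrNz /fractional addrAC addrA.
have /finite_seqP[zs0 Ezs] := periodic_zeros_finite.
pose zs := undup zs0.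
have zsP y : y \in zs <-> Z y by rewrite mem_undup Ezs.
pose L := [seq fractional ((y + s%:~R) / nu) | y <- zs, s <- S].
have uL : uniq L.
  apply: allpairs_uniq; rewrite ?undup_uniq //.
  move=> [? ?] [? ?] /allpairsP[[y s] [/= yE sE [-> ->]]] /allpairsP[[y' s'] [/= y'E s'E [-> ->]]] /=.
  rewrite /fractional; set f := Num.floor _; set f' := Num.floor _ => E.
  have {}E : y - y' = (s' - s + N * (f - f'))%:~R.
    rewrite !(intrD, intrM, mulrNz); move/(congr1 (fun x => x * nu)): E.
    by rewrite !mulrBl !divfK //; lra.
  have [/andP[y_ge0 y_lt1] _] := (zsP y).1 yE.
  have [/andP[y'_ge0 y'_lt1] _] := (zsP y').1 y'E.
  have k0 : s' - s + N * (f - f') = 0.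
    have : `|y - y'| < 1 by rewrite ltr_norml; lra.
    rewrite E -intr_norm ltrz1; move: (s' - s + N * (f - f')) => k; clear; lia.
  have -> : y = y' by apply/eqP; rewrite -subr_eq0 E k0.
  (* Otherwise [s - s'] is a multiple of [N], so [M_orth] and periodicity give [M 0 = 0], against
     [w_refine] at 0. *)
  congr (_, _); apply/eqP/negPn/negP => ss'; have := M_orth sE s'E ss'.
  have -> : s - s' = N * (f - f').
    by move: k0; move: (N * (f - f')) => m; clear; lia.
  rewrite intrM mulrC mulKf // -[_%:~R]add0r M_periodic => M0.
  have := w_refine 0; rewrite w0 mul0r M0 mul0r => /eqP.
  by rewrite oner_eq0.
have sL : \sum_(y <- L) M y = (size zs)%:R.
  rewrite big_allpairs_dep -sum1_size natr_sum; apply: eq_bigr => y _.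
  rewrite -[RHS](M_sum y); apply: eq_bigr => s _.
  by rewrite /fractional -mulrNz M_periodic.
(* Where [M] is nonzero, the refinement equation passes the vanishing of [w] from the class of [x']
   to the class of [(x' + s) / N]. *)
have LZ y : y \in L -> M y != 0 -> y \in zs.
  case/allpairsP => -[x' s] [/= /zsP[_ x'Z] sS ->] My.
  apply/zsP; split; first exact: fractional_itv.
  move=> k; move: My; rewrite /fractional -mulrNz M_periodic => My.
  have := x'Z (s + N * (k - Num.floor ((x' + s%:~R) / nu))).
  rewrite w_refine; set f := Num.floor _.
  have -> : (x' + (s + N * (k - f))%:~R) / nu = (x' + s%:~R) / nu + (k - f)%:~R.
    by rewrite intrD intrM; field.
  rewrite M_periodic => /eqP; rewrite mulf_eq0 (negPf My) /= => /eqP.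
  by rewrite intrD mulrNz addrAC addrA.
have le1 : \sum_(y <- zs) 1 <= \sum_(y <- zs) M y.
  rewrite (eq_bigr (fun=> 1%:R)) // -natr_sum sum1_size -sL.
  have -> : \sum_(y <- L) M y = \sum_(y <- L | y \in zs) M y.
    rewrite [RHS]big_mkcond; apply: eq_big_seq => y yL.
    by case: ifPn => // yzs; apply/eqP/negPn/negP => /(LZ y yL); apply/negP.
  have -> : \sum_(y <- L | y \in zs) M y = \sum_(y <- zs | y \in L) M y.
    rewrite -big_filter -[RHS]big_filter; apply/perm_big/uniq_perm; rewrite ?filter_uniq ?undup_uniq //.
    by move=> y; rewrite !mem_filter andbC.
  by rewrite big_mkcond ler_sum // => y _; case: ifP.
have y0 : fractional x \in zs by apply/zsP.
(* All terms are at most 1 and their sum is at least their number, so each equals 1. *)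
have /M_eq1[k Ek] : M (fractional x) = 1.
  apply/eqP; rewrite eq_le M_le1 leNgt; apply/negP => My.
  move: le1; rewrite leNgt => /negP; apply.
  rewrite (big_rem (fractional x)) //= [X in _ < X](big_rem (fractional x)) //=.
  by rewrite ltr_leD // ler_sum.
have := Zx.2 (- k); rewrite Ek mulrNz subrr w0 => /eqP.
by rewrite oner_eq0.
Qed.

End PeriodicZeros.

(** Near each point of [0, 1], the [k] that works there works for all close points and all small
    [e]; compactness makes [e] uniform. Other reals reduce to their fractional part, with the floor
    absorbed by [k]. *)
Lemma uniform_lower_bound : (forall x, exists k : int, w (x + k%:~R) != 0) ->
  exists2 e : R, 0 < e & forall x, exists k : int, forall y, `|y| <= e ->
    e <= w (x + k%:~R + y).
Proof.
move=> nz.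
pose P (e x : R) := exists k : int, forall y, `|y| <= e -> e <= w (x + k%:~R + y).
have : \forall e \near 0^'+, `[0%R, 1%R] `<=` P e.
  have /compact_near_coveringP := @segment_compact R 0 1; apply => x _.
  have [k wk] := nz x; set z := x + k%:~R in wk.
  have wz : 0 < w z by rewrite lt_neqAle eq_sym wk w_ge0.
  have : \forall t \near z, w z / 2 < w t.
    by have := @w_cont z => /cvgr_gt; apply; rewrite ltr_pdivrMr //; lra.
  move=> /nbhs_ballP[d /= d0 wd].
  (* Half of [d] is spent on the move from [x] to [x'], the other half on [y]. *)
  exists (ball x (d / 2), [set e | 0 < e < Num.min (d / 2) (w z / 2)]) => /=.
    split; first by apply: nbhsx_ballx; rewrite divr_gt0.
    exists (Num.min (d / 2) (w z / 2)) => /=; first by rewrite lt_min !divr_gt0.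
    by move=> e /=; rewrite sub0r normrN => eb e0; rewrite e0 -(gtr0_norm e0).
  move=> [x' e] [/= xx' /andP[e0]]; rewrite lt_min => /andP[ed ew].
  exists k => y ye; apply/ltW/(lt_trans ew)/wd.
  move: xx'; rewrite /ball /= /z => xx'.
  have -> : x + k%:~R - (x' + k%:~R + y) = (x - x') - y by ring.
  by rewrite (le_lt_trans (ler_normB _ _)) //; lra.
move=> near_e; have [e [e0 eP]] : exists e, 0 < e /\ `[0%R, 1%R] `<=` P e.
  by have [e [? ?]] := @filter_ex _ _ (at_right_proper_filter 0) _ (filterI near_e (nbhs_right_gt (0 : R))); exists e.
exists e => // x; have /andP[f0 f1] := fractional_itv x.
have [|k wk] := eP (fractional x); first by rewrite /= in_itv /= f0 ltW.
exists (k - Num.floor x) => y ye.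
have -> : x + (k - Num.floor x)%:~R = fractional x + k%:~R.
  by rewrite /fractional intrD mulrNz; ring.
exact: wk.
Qed.

Section Spectrum.
Variables (e : R) (kappa : R -> int).
Hypothesis e0 : 0 < e.
Hypothesis kappaP : forall x y, `|y| <= e -> e <= w (x + (kappa x)%:~R + y).
Variable S' : seq int.
Hypothesis S_eq : S = 0 :: S'.

(* The multiple of [N ^ n.+1] is invisible to [prodM n.+1]; it only serves to keep [w] away
   from 0. *)
Definition new_frequencies (n : nat) (L : seq int) : seq int :=
  [seq l + N ^+ n * (s + N * kappa ((l%:~R + nu ^+ n * s%:~R) / nu ^+ n.+1)) | l <- L, s <- S'].

(** The digit 0 keeps [l] with no correction, which makes the lists nested. For such a fixed [l] the
    points [(x + l) / nu ^+ n] tend to 0, where [w] is 1. *)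
Fixpoint frequencies (n : nat) : seq int :=
  if n is m.+1 then frequencies m ++ new_frequencies m (frequencies m) else [:: 0].

Definition prodM n x := \prod_(k < n) M (x / nu ^+ k.+1).

Lemma prodM_ge0 n x : 0 <= prodM n x.
Proof. by apply: prodr_ge0. Qed.

Lemma prodM_periodic n x (k : int) : prodM n (x + (N ^+ n * k)%:~R) = prodM n x.
Proof.
apply: eq_bigr => i _; rewrite -(M_periodic (x / _) (N ^+ (n - i.+1) * k)).
congr M; rewrite mulrDl; congr (_ + _).
rewrite -{1}(subnK (ltn_ord i)) exprD !intrM !rmorphXn /=.
by field; rewrite expf_neq0.
Qed.

Lemma prodMS n x : prodM n.+1 x = prodM n x * M (x / nu ^+ n.+1).
Proof. by rewrite /prodM big_ord_recr. Qed.

Lemma w_prodM n x : w x = prodM n x * w (x / nu ^+ n).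
Proof. exact: w_refine_iter. Qed.

Lemma prodM_le1 n x : prodM n x <= 1.
Proof. by apply: prodr_ile1 => i _; rewrite M_ge0 M_le1. Qed.

(** The successors of [l], one for each digit of [S], share the factor [prodM n (x + l)] by
    periodicity, and their last factors add up to 1 by [M_sum]. *)
Lemma sum_prodM n x : \sum_(l <- frequencies n) prodM n (x + l%:~R) = 1.
Proof.
elim: n => [|n IH]; first by rewrite /= big_seq1 /prodM big_ord0.
rewrite /= big_cat /= /new_frequencies big_allpairs_dep /= -big_split /= -[RHS]IH.
apply: eq_bigr => l _.
transitivity (prodM n (x + l%:~R) * \sum_(s <- S) M (((x + l%:~R) / nu ^+ n + s%:~R) / nu)).
  rewrite prodMS S_eq big_cons mulrDr.
  congr (_ * M _ + _); first by rewrite mulr0z addr0 exprSr invfM mulrA.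
  rewrite mulr_sumr; apply: eq_bigr => s _; rewrite prodMS.
  set q := kappa _; rewrite intrD addrA prodM_periodic; congr (_ * _).
  rewrite -(M_periodic (_ / nu) q); congr M.
  by rewrite !(intrD, intrM) rmorphXn /= exprSr; field; rewrite nu0 expf_neq0.
by rewrite M_sum mulr1.
Qed.

Lemma M_at0 : M 0 = 1.
Proof. by have := w_refine 0; rewrite mul0r w0 mulr1. Qed.

Lemma prodM0 n : prodM n 0 = 1.
Proof. by rewrite /prodM big1 // => i _; rewrite mul0r M_at0. Qed.

(* At [x = - l] the term of [sum_prodM] for [l] is already 1, so [l] occurs once and the other
   terms vanish. *)
Lemma uniq_frequencies n : uniq (frequencies n).
Proof.
apply: count_mem_uniq => l; apply/eqP; rewrite eqn_leq; apply/andP; split; last first.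
  by rewrite -has_pred1 has_count; case: (count _ _).
have := sum_prodM n (- l%:~R).
rewrite (bigID (pred1 l)) /= (eq_bigr (fun=> 1%:R)) => [|k /eqP ->]; last first.
  by rewrite addrC subrr prodM0.
rewrite -natr_sum sum1_count => E.
have : (count_mem l (frequencies n))%:R <= 1 :> R.
  by rewrite -[leRHS]E lerDl sumr_ge0 // => k _; exact: prodM_ge0.
by rewrite (ler_nat R _ 1) -has_pred1 has_count; case: (count _ _) => // -[].
Qed.

(** [prodM n] is a factor of [w], and [sum_prodM] at [- l'] leaves no mass for [l]. *)
Lemma frequencies_orthogonal n : {in frequencies n &, forall l l', l != l' ->
  w (l - l')%:~R = 0}.
Proof.
move=> l l' lE l'E ll'; rewrite (w_prodM n).
have := sum_prodM n (- l'%:~R).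
have lr : l \in rem l' (frequencies n) by rewrite rem_mem.
rewrite (big_rem l') //= addNr prodM0 (big_rem l) //= -[RHS]addr0 => /addrI/eqP.
rewrite paddr_eq0 ?prodM_ge0 ?sumr_ge0 // => [/andP[/eqP E _]|*]; last exact: prodM_ge0.
by rewrite intrD mulrNz addrC E mul0r.
Qed.

Lemma w_monotone x m n : (m <= n)%N -> w (x / nu ^+ m) <= w (x / nu ^+ n).
Proof.
elim: n => [|n IH]; first by rewrite leqn0 => /eqP ->.
rewrite leq_eqVlt => /predU1P[-> //|/IH /le_trans]; apply.
by rewrite (w_refine (x / nu ^+ n)) -mulrA -invfM -exprSr ler_piMl.
Qed.

(** An entry [l] of [T] was created at some stage [i >= k], where [kappa] put [l / nu ^+ i.+1] at a
    point within distance [e] of which [w] is at least [e]. The bound on [x] keeps [x / nu ^+ i.+1]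
    that small, and [w_monotone] carries the estimate to later [m]. *)
Lemma frequencies_tail k n : (k <= n)%N -> exists2 T,
  frequencies n = frequencies k ++ T &
  {in T, forall l m x, (n <= m)%N -> `|x| <= e * `|nu| ^+ k ->
     e <= w ((x + l%:~R) / nu ^+ m)}.
Proof.
elim: n => [|n IH]; first by rewrite leqn0 => /eqP ->; exists [::]; rewrite ?cats0.
rewrite leq_eqVlt => /predU1P[->|kn]; first by exists [::]; rewrite ?cats0.
have [T ET TP] := IH kn.
exists (T ++ new_frequencies n (frequencies n)); first by rewrite /= catA -ET.
move=> l; rewrite mem_cat => /orP[lT|/allpairsP lnew] m x nm xk; first by apply: TP => //; exact: ltnW.
case: lnew => -[l' s] [/= _ _ El].
apply: le_trans (w_monotone _ nm).
have -> : (x + l%:~R) / nu ^+ n.+1 = (l'%:~R + nu ^+ n * s%:~R) / nu ^+ n.+1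
    + (kappa ((l'%:~R + nu ^+ n * s%:~R) / nu ^+ n.+1))%:~R + x / nu ^+ n.+1.
  rewrite El; set q := kappa _.
  by rewrite !(intrD, intrM) rmorphXn /= exprSr; field; rewrite nu0 expf_neq0.
apply: kappaP; rewrite normrM normfV normrX ler_pdivrMr ?exprn_gt0 ?normr_gt0 //.
by apply: le_trans xk _; rewrite ler_pM2l // ler_eXn2l // ltnW.
Qed.

Lemma near0_scaled (P : R -> Prop) x : (\forall y \near 0, P y) ->
  exists n, forall m, (n <= m)%N -> P (x / nu ^+ m).
Proof.
move=> /nbhs_ballP[r /= r0 rP].
have x1 : 0 < `|x| + 1 by rewrite ltr_wpDl.
have [n nr] := expr_nu_big (divr_gt0 r0 x1).
exists n => m nm; apply: rP; rewrite /ball /= sub0r normrN normrM normfV.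
apply: (@le_lt_trans _ _ ((`|x| + 1) * `|nu ^+ n|^-1)).
  apply: ler_pM; rewrite ?invr_ge0 // ?lerDl // lef_pV2 ?posrE ?normr_gt0 ?expf_neq0 //.
  by rewrite !normrX ler_eXn2l.
by rewrite mulrC -ltr_pdivlMr.
Qed.

Lemma w_le1 x : w x <= 1.
Proof.
apply/ler_addgt0Pr => d d0.
have near_w : \forall y \near 0, w y <= 1 + d.
  by have := @w_cont 0 => /cvgr_le; apply; rewrite w0 ltrDl.
have [n /(_ n (leqnn n)) wn] := near0_scaled x near_w.
by apply: le_trans wn; have := w_monotone x (leq0n n); rewrite expr0 divr1.
Qed.

Lemma w_limit x d : 0 < d -> exists n, forall m, (n <= m)%N -> 1 - d <= w (x / nu ^+ m).
Proof.
move=> d0; apply: (@near0_scaled (fun y => 1 - d <= w y)).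
have near_w : \forall y \near 0, 1 - d <= w y.
  by have := @w_cont 0 => /cvgr_ge; apply; rewrite w0 ltrBlDr ltrDl.
exact: near_w.
Qed.

Lemma sum_w_le1 n x : \sum_(l <- frequencies n) w (x + l%:~R) <= 1.
Proof.
rewrite -[leRHS](sum_prodM n x); apply: ler_sum => l _.
by rewrite (w_prodM n) ler_piMr ?prodM_ge0 ?w_le1.
Qed.

Lemma sum_w_monotone x m n : (m <= n)%N ->
  \sum_(l <- frequencies m) w (x + l%:~R) <= \sum_(l <- frequencies n) w (x + l%:~R).
Proof.
by case/frequencies_tail => T -> _; rewrite big_cat lerDl sumr_ge0.
Qed.

Lemma sum_prodM_limit x d (L : seq int) : 0 < d -> exists n, forall m, (n <= m)%N ->
  \sum_(l <- L) prodM m (x + l%:~R) <= \sum_(l <- L) w (x + l%:~R) + d.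
Proof.
elim: L d => [|l L IH] d d0; first by exists 0%N => m _; rewrite !big_nil add0r ltW.
have d2 : 0 < d / 2 by rewrite divr_gt0.
have [n1 H1] := IH _ d2; have [n2 H2] := w_limit (x + l%:~R) d2.
exists (maxn n1 n2) => m; rewrite geq_max => /andP[/H1 m1 /H2 m2].
rewrite !big_cons; have : prodM m (x + l%:~R) <= w (x + l%:~R) + d / 2.
  rewrite [in leRHS](w_prodM m) -lerBlDl -{1}[prodM m _]mulr1 -mulrBr.
  have q1 : 0 <= 1 - w ((x + l%:~R) / nu ^+ m) by rewrite subr_ge0 w_le1.
  by have := ler_piMl q1 (prodM_le1 m (x + l%:~R)); lra.
by lra.
Qed.

(* Beyond [frequencies k] the weights [prodM] are dominated by [w / e], so the total mass 1
   of [prodM n] on [frequencies n] cannot escape to infinity. *)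
Lemma sum_w_limit x d : 0 < d -> exists n, forall m, (n <= m)%N ->
  1 - d <= \sum_(l <- frequencies m) w (x + l%:~R).
Proof.
move=> d0; have d2 : 0 < d / 2 by rewrite divr_gt0.
pose Q n := \sum_(l <- frequencies n) w (x + l%:~R).
have [k0 k0P] : exists k0, `|x| <= e * `|nu| ^+ k0.
  have x1 : 0 < `|x| + 1 by rewrite ltr_wpDl.
  have [k kP] := expr_nu_big (divr_gt0 e0 x1); exists k.
  move: kP; rewrite normrX invf_plt ?posrE ?exprn_gt0 ?normr_gt0 ?divr_gt0 //.
  by rewrite invf_div ltr_pdivrMr // mulrC; lra.
(* [Q] is nondecreasing and bounded by 1, so from some [k] on it gains at most [e * (d / 2)];
   divided by [e], this bounds the tail of the weights by [d / 2]. *)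
have [k k0k Qk] : exists2 k, (k0 <= k)%N & forall n, (k <= n)%N -> Q n - Q k <= e * (d / 2).
  have sQ : has_sup (range Q).
    split; first by exists (Q 0%N), 0%N.
    by exists 1 => _ [n _ <-]; exact: sum_w_le1.
  have [_ [k1 _ <-] k1P] := sup_adherent (mulr_gt0 e0 d2) sQ.
  exists (maxn k0 k1); first exact: leq_maxl.
  move=> n _; have := sum_w_monotone x (leq_maxr k0 k1); rewrite -/(Q _) -/(Q _) => Q1.
  have : Q n <= sup (range Q) by apply: ub_le_sup; [exact: sQ.2|exists n].
  by lra.
have [n1 n1P] := sum_prodM_limit x (frequencies k) d2.
exists k => m km; apply: le_trans (sum_w_monotone x km).
set n := maxn n1 k.
have kn : (k <= n)%N by exact: leq_maxr.
have [T ET TP] := frequencies_tail kn.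
have := sum_prodM n x; rewrite ET big_cat /=.
have Tw : e * \sum_(l <- T) prodM n (x + l%:~R) <= \sum_(l <- T) w (x + l%:~R).
  rewrite mulr_sumr big_seq [leRHS]big_seq; apply: ler_sum => l lT.
  rewrite (w_prodM n) mulrC ler_wpM2l ?prodM_ge0 //; apply: TP => //.
  by apply: le_trans k0P _; rewrite ler_pM2l // ler_eXn2l.
have := Qk n kn; rewrite /Q ET big_cat /= addrAC subrr add0r => Td.
have {}Td : \sum_(l <- T) prodM n (x + l%:~R) <= d / 2.
  by rewrite -(ler_pM2l e0) (le_trans Tw).
by have := n1P n (leq_maxl _ _); lra.
Qed.

End Spectrum.

Lemma frequencies_exist S' : S = 0 :: S' ->
  (forall x, exists k : int, w (x + k%:~R) != 0) ->
  exists L : nat -> seq int, [/\ forall n, uniq (L n),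
    forall n, {in L n &, forall l l', l != l' -> w (l - l')%:~R = 0},
    forall m n, (m <= n)%N -> exists T, L n = L m ++ T &
    forall x d, 0 < d -> exists n, forall m, (n <= m)%N ->
      1 - d <= \sum_(l <- L m) w (x + l%:~R)].
Proof.
move=> ES /uniform_lower_bound[e e0 He].
have /choice[kappa kappaP] : forall x, exists k : int, forall y, `|y| <= e ->
  e <= w (x + k%:~R + y) by [].
exists (frequencies kappa S'); split.
- exact: uniq_frequencies.
- exact: frequencies_orthogonal.
- by move=> m n mn; have [T ET _] := frequencies_tail e0 kappaP S' mn; exists T.
- exact: (sum_w_limit e0 kappaP ES).
Qed.

End Refinement.

(** * Density of the exponentials in L2 *)

Section NormSquare.
Context {R : realType}.
Implicit Types z u : R[i].

Definition normsq z : R := complex.Re z ^+ 2 + complex.Im z ^+ 2.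

Lemma normsq_ge0 z : 0 <= normsq z.
Proof. by rewrite addr_ge0 ?sqr_ge0. Qed.

Lemma normsqM z u : normsq (z * u) = normsq z * normsq u.
Proof. by case: z u => [a b] [c d]; rewrite /normsq /=; ring. Qed.

Lemma normsqD z u : normsq (z + u) <= 2 * normsq z + 2 * normsq u.
Proof.
case: z u => [a b] [c d]; rewrite /normsq /=.
by have := sqr_ge0 (a - c); have := sqr_ge0 (b - d); nra.
Qed.

Lemma normsqC (x : R) : normsq x%:C%C = x ^+ 2.
Proof. by rewrite /normsq /= expr0n addr0. Qed.

Lemma normc_sqr z : Normc.normc z ^+ 2 = normsq z.
Proof. by case: z => a b; rewrite /Normc.normc sqr_sqrtr // addr_ge0 ?sqr_ge0. Qed.

End NormSquare.

Section Energy.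
Context {R : realType}.
Variable mu : probability (measurableTypeR R) R.
Implicit Types f g : R -> R[i].

(** The square of the L2 norm ([L2norm_sqr]). For approximation the crude [energyD], with its factor
    2, replaces the triangle inequality. *)
Definition energy f : \bar R := (\int[mu]_t (normsq (f t))%:E)%E.

Lemma cmeasurableD f g : cmeasurable f -> cmeasurable g -> cmeasurable (fun t => f t + g t).
Proof.
move=> [f1 f2] [g1 g2]; split.
  rewrite (_ : (fun t => _) = (fun t => complex.Re (f t)) \+ (fun t => complex.Re (g t))).
    exact: measurable_funD.
  by apply/funext => t /=; case: (f t) (g t) => [a b] [c d].
rewrite (_ : (fun t => _) = (fun t => complex.Im (f t)) \+ (fun t => complex.Im (g t))).
  exact: measurable_funD.
by apply/funext => t /=; case: (f t) (g t) => [a b] [c d].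
Qed.

Lemma cmeasurableM f g : cmeasurable f -> cmeasurable g -> cmeasurable (fun t => f t * g t).
Proof.
move=> [f1 f2] [g1 g2]; split.
  rewrite (_ : (fun t => _) = ((fun t => complex.Re (f t)) \* (fun t => complex.Re (g t)))
    \- ((fun t => complex.Im (f t)) \* (fun t => complex.Im (g t)))).
    by apply: measurable_funB; apply: measurable_funM.
  by apply/funext => t /=; case: (f t) (g t) => [a b] [c d].
rewrite (_ : (fun t => _) = ((fun t => complex.Re (f t)) \* (fun t => complex.Im (g t)))
    \+ ((fun t => complex.Im (f t)) \* (fun t => complex.Re (g t)))).
  by apply: measurable_funD; apply: measurable_funM.
by apply/funext => t /=; case: (f t) (g t) => [a b] [c d].
Qed.

Lemma cmeasurable_cst (c : R[i]) : cmeasurable (fun=> c).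
Proof. by split; exact: measurable_cst. Qed.

Lemma cmeasurableB f g : cmeasurable f -> cmeasurable g -> cmeasurable (fun t => f t - g t).
Proof.
move=> mf mg; rewrite (_ : (fun t => _) = (fun t => f t + (-1) * g t)).
  by apply: cmeasurableD => //; apply: cmeasurableM => //; exact: cmeasurable_cst.
by apply/funext => t; rewrite mulN1r.
Qed.

Lemma cmeasurable_real (f : R -> R) :
  cmeasurable (fun t => (f t)%:C%C) <-> measurable_fun [set: measurableTypeR R] f.
Proof. by split=> [[]//|mf]; split=> //; exact: measurable_cst. Qed.

Lemma cmeasurable_exponential l : cmeasurable (exponential l : R -> R[i]).
Proof.
have ml : measurable_fun [set: measurableTypeR R] (fun t : R => 2 * pi * (l * t)).
  by apply: measurable_funM => //; apply: measurable_funM.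
split; rewrite /exponential /e2pi /=.
  by apply: (measurableT_comp (continuous_measurable_fun _) ml); exact: continuous_cos.
by apply: (measurableT_comp (continuous_measurable_fun _) ml); exact: continuous_sin.
Qed.

Lemma measurable_normsq f : cmeasurable f ->
  measurable_fun [set: measurableTypeR R] (fun t => normsq (f t)).
Proof.
by move=> [f1 f2]; apply: measurable_funD; apply: measurable_funX.
Qed.

Lemma energy_ge0 f : (0 <= energy f)%E.
Proof. by apply: integral_ge0 => t _; rewrite lee_fin normsq_ge0. Qed.

Lemma energyD f g : cmeasurable f -> cmeasurable g ->
  (energy (fun t => (f t + g t)%R) <= 2%:E * energy f + 2%:E * energy g)%E.
Proof.
move=> mf mg.
have Z h : cmeasurable h ->
    (2%:E * energy h = \int[mu]_t (2%:E * (normsq (h t))%:E))%E.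
  move=> mh; rewrite -ge0_integralZl_EFin //.
    by move=> t _; rewrite lee_fin normsq_ge0.
  by apply/measurable_EFinP; exact: measurable_normsq.
rewrite (Z f) // (Z g) // /energy.
have m2 h : cmeasurable h -> measurable_fun [set: measurableTypeR R]
    (fun t => 2%:E * (normsq (h t))%:E)%E.
  move=> mh; apply/measurable_EFinP; apply: measurable_funM => //.
  exact: measurable_normsq.
have h0 h t : (0 <= 2%:E * (normsq (h t : R[i]))%:E)%E by rewrite -EFinM lee_fin mulr_ge0 ?normsq_ge0.
rewrite -ge0_integralD //; [|exact: m2|exact: m2].
apply: ge0_le_integral; rewrite ?measurableT //.
- by move=> t _; exact: normsq_ge0.
- by apply/measurable_EFinP; apply: measurable_normsq; exact: cmeasurableD.
- by apply: emeasurable_funD; exact: m2.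
- by move=> t _; rewrite -!EFinM -EFinD lee_fin normsqD.
Qed.

Lemma energyZ (c : R[i]) f : cmeasurable f ->
  energy (fun t => c * f t) = ((normsq c)%:E * energy f)%E.
Proof.
move=> mf; rewrite /energy -ge0_integralZl_EFin ?normsq_ge0 //.
- by apply: eq_integral => t _; rewrite normsqM EFinM.
- by move=> t _; rewrite lee_fin normsq_ge0.
- by apply/measurable_EFinP; exact: measurable_normsq.
Qed.

Lemma L2norm_sqr f : (L2norm mu f `^ 2)%E = energy f.
Proof.
rewrite /L2norm poweR_Lnorm //; apply: eq_integral => t _ /=.
have n0 : 0 <= Normc.normc (f t) by case: (f t) => a b; exact: sqrtr_ge0.
by rewrite ger0_norm // (powR_mulrn 2) // normc_sqr.
Qed.

Lemma energy_L2norm_lt f e : 0 < e -> (energy f < (e ^+ 2)%:E)%E -> (L2norm mu f < e%:E)%E.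
Proof.
move=> e0; rewrite -L2norm_sqr => Ef; rewrite ltNge; apply/negP => eL.
have : (e%:E `^ 2 <= L2norm mu f `^ 2)%E.
  apply: gt0_ler_poweR => //; first by rewrite in_itv /= leey lee_fin ltW.
  by rewrite in_itv /= leey andbT Lnorm_ge0.
by rewrite poweR_EFin (powR_mulrn 2 (ltW e0)) leNgt Ef.
Qed.

Lemma L2_energy_fin f : L2 mu f -> (energy f < +oo)%E.
Proof. by move=> [_ Lf]; rewrite -L2norm_sqr poweR_lty. Qed.

End Energy.

Section TrigonometricPolynomials.
Context {R : realType}.

Definition trigonometric (f : R -> R[i]) : Prop := exists s : seq (R[i] * R),
  f = fun t => \sum_(x <- s) x.1 * exponential x.2 t.

Lemma trigonometric_exp l : trigonometric (exponential l).
Proof. by exists [:: (1, l)]; apply/funext => t; rewrite big_seq1 mul1r. Qed.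

Lemma trigonometricD f g : trigonometric f -> trigonometric g ->
  trigonometric (fun t => f t + g t).
Proof. by move=> [s ->] [s' ->]; exists (s ++ s'); apply/funext => t; rewrite big_cat. Qed.

Lemma trigonometricM f g : trigonometric f -> trigonometric g ->
  trigonometric (fun t => f t * g t).
Proof.
move=> [s ->] [s' ->]; exists [seq (x.1 * y.1, x.2 + y.2) | x <- s, y <- s'].
apply/funext => t; rewrite big_allpairs_dep mulr_suml; apply: eq_bigr => x _.
rewrite mulr_sumr; apply: eq_bigr => y _ /=.
by rewrite /exponential mulrDl e2piD; ring.
Qed.

Lemma trigonometric_cst c : trigonometric (fun=> c).
Proof.
by exists [:: (c, 0)]; apply/funext => t; rewrite big_seq1 /= /exponential mul0r e2pi0 mulr1.
Qed.

Lemma trigonometricX f n : trigonometric f -> trigonometric (fun t => f t ^+ n).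
Proof.
move=> tf; elim: n => [|n IH]; first exact: trigonometric_cst.
under eq_fun do rewrite exprS.
exact: trigonometricM.
Qed.

Lemma trigonometric_sin (l a : R) : trigonometric (fun t => (sin (2 * pi * (l * t + a)))%:C%C).
Proof.
(* [Complex 0 (- 2^-1)] is [1 / (2 i)]: Euler's formula for the sine. *)
rewrite (_ : (fun t => _) = fun t => (Complex 0 (- 2^-1) * e2pi a) * exponential l t
   + (Complex 0 2^-1 * e2pi (- a)) * exponential (- l) t).
  by apply: trigonometricD; apply: trigonometricM;
    [exact: trigonometric_cst|exact: trigonometric_exp|exact: trigonometric_cst|exact: trigonometric_exp].
apply/funext => t.
have E1 : e2pi a * exponential l t = e2pi (l * t + a) by rewrite e2piD mulrC.
have E2 : e2pi (- a) * exponential (- l) t = conjc (e2pi (l * t + a)).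
  by rewrite -e2piN opprD e2piD mulrC -mulNr.
rewrite -(mulrA _ (e2pi a)) -(mulrA _ (e2pi (- a))) E1 E2 /e2pi.
move: (cos (2 * pi * (l * t + a))) (sin (2 * pi * (l * t + a))) => x y.
by apply/eqP; rewrite eq_complex /=; apply/andP; split; apply/eqP; field.
Qed.

End TrigonometricPolynomials.

Section Density.
Context {R : realType}.
Variable mu : probability (measurableTypeR R) R.
(** A linear space, closed in energy, that contains all exponentials; it will be the space of
    functions approximable by the chosen ones. *)
Variable V : (R -> R[i]) -> Prop.
Hypothesis V_measurable : forall f, V f -> cmeasurable f.
Hypothesis V_exp : forall l, V (exponential l).
Hypothesis V_add : forall f g, V f -> V g -> V (fun t => f t + g t).
Hypothesis V_scale : forall c f, V f -> V (fun t => c * f t).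
Hypothesis V_closed : forall f, cmeasurable f ->
  (forall e, 0 < e -> exists2 g, V g & (energy mu (fun t => (f t - g t)%R) < e%:E)%E) -> V f.

Lemma V_trigonometric f : trigonometric f -> V f.
Proof.
move=> [s ->]; elim: s => [|x s IH].
  under eq_fun do rewrite big_nil.
  rewrite (_ : (fun=> 0) = fun t => 0 * @exponential R 0 t); first exact: V_scale.
  by apply/funext => t; rewrite mul0r.
under eq_fun do rewrite big_cons.
by apply: V_add => //; exact: V_scale.
Qed.

Definition RV (f : R -> R) := V (fun t => (f t)%:C%C).

Lemma RV_measurable f : RV f -> measurable_fun [set: measurableTypeR R] f.
Proof. by move=> /V_measurable/cmeasurable_real. Qed.

Lemma RV_add f g : RV f -> RV g -> RV (fun t => f t + g t).
Proof. by move=> vf vg; rewrite /RV; under eq_fun do rewrite rmorphD /=; exact: V_add. Qed.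

Lemma RV_scale c f : RV f -> RV (fun t => c * f t).
Proof. by move=> vf; rewrite /RV; under eq_fun do rewrite rmorphM /=; exact: V_scale. Qed.

Lemma RV_cst c : RV (fun=> c).
Proof. by apply: V_trigonometric; exact: trigonometric_cst. Qed.

Lemma RV_sum (I : Type) (r : seq I) (f : I -> R -> R) :
  (forall i, RV (f i)) -> RV (fun t => \sum_(i <- r) f i t).
Proof.
move=> vf; elim: r => [|i r IH].
  by under eq_fun do rewrite big_nil; exact: RV_cst.
by under eq_fun do rewrite big_cons; exact: RV_add.
Qed.

(** Dominated convergence for the squared errors, whose integrals are the energies of [f - f_ n];
    hence [g] bounds squares. *)
Lemma RV_dominated (f_ : nat -> R -> R) (f : R -> R) (g : R -> R) :
  (forall n, RV (f_ n)) -> (forall t, f_ n t @[n --> \oo] --> f t) ->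
  mu.-integrable setT (EFin \o g) ->
  (forall n t, (f t - f_ n t) ^+ 2 <= g t) -> RV f.
Proof.
move=> vf f_f ig fg.
have mf : measurable_fun [set: measurableTypeR R] f.
  apply: (@measurable_fun_cvg _ (measurableTypeR R) R setT f_ f) => [n|t _].
    exact: RV_measurable.
  exact: f_f.
apply: V_closed => [|e e0]; first exact/cmeasurable_real.
pose h n t := ((f t - f_ n t) ^+ 2)%:E.
have mh n : measurable_fun [set: measurableTypeR R] (h n).
  by apply/measurable_EFinP; apply: measurable_funX; apply: measurable_funB => //; exact: RV_measurable.
have h0 : {ae mu, forall t, [set: measurableTypeR R] t -> h n t @[n --> \oo] --> cst 0%E t}.
  apply: aeW => t _; apply/cvg_EFin; first by apply: nearW.
  rewrite -[X in _ --> X](_ : (f t - f t) ^+ 2 = 0); last by rewrite subrr expr0n.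
  rewrite expr2; apply: cvgM; apply: cvgB => //; try exact: cvg_cst; exact: f_f.
have hg : {ae mu, forall x n, [set: measurableTypeR R] x -> (`|h n x| <= (EFin \o g) x)%E}.
  by apply: aeW => t n _; rewrite /h /= lee_fin ger0_norm ?sqr_ge0.
have [_ _] := @dominated_convergence _ _ _ mu setT measurableT h (cst 0%E) (EFin \o g)
  mh (measurable_cst _) h0 ig hg.
rewrite integral0 => /fine_cvgP[hfin /cvgr_lt/(_ _ e0) hlt].
have [n [hn1 hn2]] := filter_ex (filterI hfin hlt).
exists (fun t => (f_ n t)%:C%C); first exact: vf.
rewrite [X in (X < _)%E](_ : _ = (\int[mu]_t h n t)%E); last first.
  by apply: eq_integral => t _; rewrite -rmorphB /= normsqC.
by move: hn1 hn2 => /= /fineK <-; rewrite lte_fin.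
Qed.

Lemma RV_bounded (f_ : nat -> R -> R) (f : R -> R) (K : R) :
  (forall n, RV (f_ n)) -> (forall t, f_ n t @[n --> \oo] --> f t) ->
  (forall n t, 0 <= f_ n t <= K) -> RV f.
Proof.
move=> vf f_f fK.
have fK' t : 0 <= f t <= K.
  apply/andP; split.
    by apply: (cvgr_to_ge (f_f t)); apply: nearW => n; case/andP: (fK n t).
  by apply: (cvgr_to_le (f_f t)); apply: nearW => n; case/andP: (fK n t).
apply: (@RV_dominated f_ f (cst (K ^+ 2))) => //.
  exact: finite_measure_integrable_cst.
by move=> n t /=; move: (fK n t) (fK' t); nra.
Qed.

(** This bound and the next give the limits in [RV_threshold], where [x = v ^+ n] and [m = 2 ^ n]
    make [x *+ m] equal to [(2 * v) ^+ n]. *)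
Lemma bernoulli_ge (x : R) m : 0 <= x <= 1 -> 1 - x *+ m <= (1 - x) ^+ m.
Proof.
move=> /andP[x0 x1]; elim: m => [|m IH]; first by rewrite mulr0n subr0 expr0.
rewrite exprS mulrS; have : 0 <= x *+ m by rewrite mulrn_wge0.
have : (1 - x) * (1 - x *+ m) <= (1 - x) * (1 - x) ^+ m by rewrite ler_wpM2l // subr_ge0.
by move: (x *+ m) => y; nra.
Qed.

Lemma bernoulli_le (x : R) m : 0 <= x <= 1 -> (1 - x) ^+ m * (1 + x *+ m) <= 1.
Proof.
move=> /andP[x0 x1]; elim: m => [|m IH]; first by rewrite mulr0n addr0 expr0 mulr1.
rewrite exprS mulrS; have y0 : 0 <= x *+ m by rewrite mulrn_wge0.
have p0 : 0 <= (1 - x) ^+ m by rewrite exprn_ge0 // subr_ge0.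
apply: le_trans IH; rewrite -mulrA [X in X <= _]mulrCA ler_wpM2l //.
by move: (x *+ m) y0 => y y0; nra.
Qed.

(* [(1 - v ^ n) ^ (2 ^ n)] tends to 1 where [v < 1/2] and to 0 where [v > 1/2]; where
   [v = 1/2] it is monotone, and the value of its limit is irrelevant. *)
Lemma RV_threshold (v : R -> R) : trigonometric (fun t => (v t)%:C%C) ->
  (forall t, 0 <= v t <= 1) ->
  exists g : R -> R, [/\ RV g, forall t, 0 <= g t <= 1,
    forall t, v t < 2^-1 -> g t = 1 & forall t, 2^-1 < v t -> g t = 0].
Proof.
move=> tv v01.
pose q n t := (1 - v t ^+ n) ^+ (2 ^ n).
have q01 n t : 0 <= q n t <= 1.
  have /andP[v0 v1] := v01 t.
  have [p0 p1] : 0 <= v t ^+ n /\ v t ^+ n <= 1 by rewrite exprn_ge0 ?exprn_ile1.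
  by rewrite /q exprn_ge0 ?exprn_ile1; lra.
have Rq n : RV (q n).
  apply: V_trigonometric.
  rewrite (_ : (fun t => _) = fun t => (1 + (-1) * (v t)%:C%C ^+ n) ^+ (2 ^ n)).
    apply/trigonometricX/trigonometricD; first exact: trigonometric_cst.
    by apply: trigonometricM; [exact: trigonometric_cst|exact: trigonometricX].
  by apply/funext => t; rewrite /q mulN1r rmorphXn rmorphB rmorph1 rmorphXn.
have x01 n t : 0 <= v t ^+ n <= 1.
  by have /andP[v0 v1] := v01 t; rewrite exprn_ge0 ?exprn_ile1.
have x2n n t : v t ^+ n *+ 2 ^ n = (2 * v t) ^+ n.
  by rewrite -mulr_natl natrX exprMn.
have q_low t : v t < 2^-1 -> q n t @[n --> \oo] --> (1 : R).
  move=> vt; have /andP[v0 v1] := v01 t.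
  apply: (@squeeze_cvgr _ _ _ _ (fun n => 1 - (2 * v t) ^+ n) (cst 1)).
  - apply: nearW => n /=; rewrite -x2n bernoulli_ge //=.
    by case/andP: (q01 n t).
  - rewrite -[X in _ --> X]subr0; apply: cvgB; first exact: cvg_cst.
    by apply: cvg_expr; rewrite ger0_norm; lra.
  - exact: cvg_cst.
have q_high t : 2^-1 < v t -> q n t @[n --> \oo] --> (0 : R).
  move=> vt; have /andP[v0 v1] := v01 t.
  apply: (@squeeze_cvgr _ _ _ _ (cst 0) (fun n => ((2 * v t)^-1) ^+ n)).
  - apply: nearW => n /=; apply/andP; split; first by case/andP: (q01 n t).
    have p0 : 0 < (2 * v t) ^+ n by rewrite exprn_gt0 //; lra.
    rewrite exprVn -[leRHS]mul1r ler_pdivlMr //.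
    have := bernoulli_le (2 ^ n) (x01 n t); rewrite x2n; apply: le_trans.
    by rewrite ler_wpM2l ?lerDr //; case/andP: (q01 n t).
  - exact: cvg_cst.
  - apply: cvg_expr; rewrite ger0_norm ?invr_ge0; last by lra.
    by rewrite invf_lt1; lra.
have q_mid t : v t = 2^-1 -> cvgn (q ^~ t).
  move=> vt; apply: nondecreasing_is_cvgn.
    apply/nondecreasing_seqP => n.
    rewrite /q vt expnS exprM; apply: lerXn2r; rewrite ?nnegrE ?sqr_ge0 //.
      by have := x01 n t; rewrite vt; lra.
    by rewrite [2^-1 ^+ n.+1]exprS; move: (2^-1 ^+ n) => y; nra.
  by exists 1 => _ [n _ <-]; case/andP: (q01 n t).
pose g t := limn (q ^~ t).
have qg t : q n t @[n --> \oo] --> g t.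
  have [vt|vt|vt] := ltgtP (v t) 2^-1.
  - by apply/cvgP; exact: q_low.
  - by apply/cvgP; exact: q_high.
  - exact: q_mid.
exists g; split.
- exact: (RV_bounded Rq qg q01).
- move=> t; apply/andP; split.
    by apply: (cvgr_to_ge (qg t)); apply: nearW => n; case/andP: (q01 n t).
  by apply: (cvgr_to_le (qg t)); apply: nearW => n; case/andP: (q01 n t).
- by move=> t /q_low; apply: cvg_lim.
- by move=> t /q_high; apply: cvg_lim.
Qed.

Lemma sin_gt0_half (x : R) : 0 < x < 2^-1 -> 0 < sin (2 * pi * x).
Proof. by move=> x01; apply: sin_gt0_pi; have := pi_gt0 R; nra. Qed.

(* [sin (2 pi (t - a - 1/m) / m)] is eventually positive if [a < t] and eventually negative
   otherwise. *)
Lemma RV_ray a : RV \1_(`]a, +oo[%classic : set R).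
Proof.
(* The factor [m.+1%:R^-1] stretches the period, so that a fixed [t] ends up within half a period of
   the sign change; placing that change at [a + m.+1%:R^-1] keeps [t = a] on the negative side. *)
pose v m (t : R) := (1 - sin (2 * pi * ((m.+1%:R)^-1 * t + - (m.+1%:R)^-1 * (a + m.+1%:R^-1)))) / 2.
have tv m : trigonometric (fun t => (v m t)%:C%C).
  rewrite (_ : (fun t => _) = fun t => 2^-1%:C%C + (- 2^-1)%:C%C *
    (sin (2 * pi * ((m.+1%:R)^-1 * t + - (m.+1%:R)^-1 * (a + m.+1%:R^-1))))%:C%C).
    apply: trigonometricD; first exact: trigonometric_cst.
    by apply: trigonometricM; [exact: trigonometric_cst|exact: trigonometric_sin].
  by apply/funext => t; rewrite -rmorphM -rmorphD /v; congr (_%:C)%C; field.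
have v01 m t : 0 <= v m t <= 1.
  rewrite /v; set x := 2 * pi * _.
  by have := sin_geN1 x; have := sin_le1 x; lra.
have /choice[g gP] := fun m => RV_threshold (tv m) (v01 m).
have sE m (t : R) : 2 * pi * ((m.+1%:R)^-1 * t + - (m.+1%:R)^-1 * (a + m.+1%:R^-1))
    = 2 * pi * ((t - a - m.+1%:R^-1) / m.+1%:R) by ring.
apply: (@RV_bounded g _ 1).
- by move=> m; have [] := gP m.
- move=> t; apply: cvg_near_cst.
  have [ta|ta] := ltP a t.
    have m1 := nbhs_infty_gtr (t - a)^-1; have m2 := nbhs_infty_gtr (2 * (t - a)).
    apply: filterS (filterI m1 m2) => m [/= h1 h2].
    rewrite indicE mem_set /= ?in_itv /= ?ta //.
    have [_ _ + _] := gP m; apply; rewrite /v sE.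
    suff : 0 < sin (2 * pi * ((t - a - m.+1%:R^-1) / m.+1%:R)) by lra.
    apply: sin_gt0_half; rewrite -natr1; set k := m%:R + 1.
    have k0 : 0 < k by rewrite /k natr1 ltr0n.
    have y0 : k^-1 < t - a by rewrite invf_plt ?posrE ?subr_gt0 // /k; lra.
    have yp : 0 < k^-1 by rewrite invr_gt0.
    have kE : k = m%:R + 1 by [].
    by apply/andP; split; [rewrite divr_gt0 //; lra|rewrite ltr_pdivrMr //; lra].
  have m1 := nbhs_infty_gtr (2 * (a - t) + 2).
  apply: filterS m1 => m /= h1.
  rewrite indicE memNset /= ?in_itv /= ?andbT; last by apply/negP; rewrite -leNgt.
  have [_ _ _] := gP m; apply; rewrite /v sE.
  suff : sin (2 * pi * ((t - a - m.+1%:R^-1) / m.+1%:R)) < 0 by lra.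
  rewrite -oppr_gt0 -sinN -mulrN -mulNr; apply: sin_gt0_half.
  have k1 : 1 <= m.+1%:R :> R by rewrite ler1n.
  have y1 : m.+1%:R^-1 <= 1 :> R by rewrite invf_le1 ?ltr0n.
  have yp : 0 < m.+1%:R^-1 :> R by rewrite invr_gt0 ltr0n.
  have hk : 2 * (a - t) + 2 < m.+1%:R by rewrite -natr1; lra.
  move: (m.+1%:R) k1 y1 yp hk => k k1 y1 yp hk.
  have k0 : 0 < k by lra.
  by apply/andP; split; [rewrite divr_gt0 //; lra|rewrite ltr_pdivrMr //; lra].
- by move=> m t; have [_ + _ _] := gP m; apply.
Qed.

Lemma sum_indic_disjoint (F : nat -> set R) n (t : R) : trivIset setT F ->
  \sum_(k < n) \1_(F k) t = (`[< exists2 k, (k < n)%N & F k t >])%:R :> R.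
Proof.
move=> tF; case: asboolP => [[k kn Fk]|noF].
  rewrite (bigD1 (Ordinal kn)) //= big1 ?addr0 => [|i ik].
    by rewrite indicE mem_set.
  rewrite indicE memNset // => Fi; move/negP: ik; apply; apply/eqP/val_inj => /=.
  by apply: (tF i k) => //; exists t.
rewrite big1 // => i _; rewrite indicE memNset // => Fi.
by apply: noF; exists (i : nat).
Qed.

(** Dynkin's theorem: open rays are stable under intersection and generate the Borel sets;
    complements follow by linearity, disjoint unions by bounded limits. *)
Lemma RV_indic (A : set (measurableTypeR R)) : measurable A -> RV \1_A.
Proof.
have ME : @measurable _ (measurableTypeR R) = <<s @RGenOInfty.G R >>.
  by have := RGenOInfty.measurableE R.
move=> mA; move: (mA); rewrite ME; move: A {mA}; apply: (@dynkin_induction _ (measurableTypeR R) _ (fun A => RV \1_A) ME).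
- move=> _ _ [a ->] [b ->]; exists (Num.max a b).
  apply/seteqP; split => x /=; rewrite !in_itv /= !andbT gt_max; first by move=> [-> ->].
  by move/andP.
- rewrite indicT; exact: RV_cst.
- by move=> _ [a ->]; exact: RV_ray.
- move=> B mB RB; rewrite (_ : \1_(~` B) = fun t => 1 + (-1) * \1_B t).
    by apply: RV_add; [exact: RV_cst|exact: RV_scale].
  by apply/funext => t; rewrite !indicE in_setC mulN1r; case: (t \in B); rewrite /= ?subrr ?subr0.
- move=> F mF tF RF.
  apply: (@RV_bounded (fun n t => \sum_(k < n) \1_(F k) t) _ 1).
  + by move=> n; exact: RV_sum.
  + move=> t; apply: cvg_near_cst; have [[k _ Fk]|noF] := pselect ((\bigcup_k F k) t).
      exists k.+1 => // n /= kn; rewrite sum_indic_disjoint //.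
      rewrite indicE mem_set; last by exists k.
      by case: asboolP => // H; exfalso; apply: H; exists k.
    apply: nearW => n; rewrite sum_indic_disjoint // indicE memNset //.
    by case: asboolP => // -[k _ Fk]; exfalso; apply: noF; exists k.
  + by move=> n t; rewrite sum_indic_disjoint //; case: asboolP; rewrite ?lexx ?ler01.
Qed.

Lemma RV_nonneg (f : R -> R) : measurable_fun [set: measurableTypeR R] f ->
  (forall t, 0 <= f t) -> mu.-integrable setT (fun t => (f t ^+ 2)%:E) -> RV f.
Proof.
move=> mf f0 if2.
have mEf : measurable_fun [set: measurableTypeR R] (EFin \o f) by apply/measurable_EFinP.
pose g_ := nnsfun_approx measurableT mEf.
have g_f t : g_ n t @[n --> \oo] --> f t.
  have f0' s : [set: measurableTypeR R] s -> (0 <= (EFin \o f) s)%E by rewrite /= lee_fin.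
  have := @cvg_nnsfun_approx _ _ _ _ measurableT _ mEf f0' t I.
  by move=> /fine_cvgP[].
have g_nd t : {homo (fun n => g_ n t) : m n / (m <= n)%N >-> m <= n}.
  by move=> m n mn; have /lefP := nd_nnsfun_approx measurableT mEf mn; apply.
have g_le n t : g_ n t <= f t.
  by apply: (cvgr_to_ge (g_f t)); exists n => // m /= nm; exact: g_nd.
apply: (@RV_dominated (fun n => g_ n : R -> R) f (fun t => f t ^+ 2)) => //.
  move=> n; rewrite (_ : (g_ n : R -> R) = fun t => \sum_(y <- fset_set (range (g_ n))) y * \1_(g_ n @^-1` [set y]) t).
    apply: RV_sum => y; apply: RV_scale; apply: RV_indic.
    exact: measurable_funPTI.
  by apply/funext => t; rewrite (fimfunE (g_ n)) fsbig_finite.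
move=> n t; have gf := g_le n t; have g0 : 0 <= g_ n t by [].
by nra.
Qed.

Lemma RV_square_integrable (h : R -> R) : measurable_fun [set: measurableTypeR R] h ->
  mu.-integrable setT (fun t => (h t ^+ 2)%:E) -> RV h.
Proof.
move=> mh ih.
have R0 (k : R -> R) : measurable_fun [set: measurableTypeR R] k ->
    (forall t, k t ^+ 2 <= h t ^+ 2) -> RV (fun t => Num.max (k t) 0).
  move=> mk kh; apply: RV_nonneg.
  - by apply: measurable_maxr => //; exact: measurable_cst.
  - by move=> t; rewrite le_max lexx orbT.
  apply: le_integrable ih => //.
    apply/measurable_EFinP; apply: measurable_funX; apply: measurable_maxr => //.
  move=> t _ /=; rewrite lee_fin !ger0_norm ?sqr_ge0 //; apply: le_trans (kh t).
  by case: (ltP (k t) 0) => //; rewrite expr0n sqr_ge0.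
have -> : h = fun t => Num.max (h t) 0 + (-1) * Num.max (- h t) 0.
  apply/funext => t; rewrite mulN1r.
  by case: (ltP (h t) 0) => ht; case: (ltP (- h t) 0) => ht'; lra.
apply: RV_add; first exact: R0.
apply: RV_scale; apply: R0 => [|t]; last by rewrite sqrrN.
exact: measurable_funN.
Qed.

Lemma V_L2 f : L2 mu f -> V f.
Proof.
move=> L2f; have [mf1 mf2] := L2f.1.
have Ef : mu.-integrable setT (fun t => (normsq (f t))%:E).
  apply/integrableP; split.
    by apply/measurable_EFinP; apply: measurable_normsq; exact: L2f.1.
  under eq_integral do rewrite gee0_abs ?lee_fin ?normsq_ge0 //.
  exact: L2_energy_fin.
rewrite (_ : f = fun t => (complex.Re (f t))%:C%C + Complex 0 1 * (complex.Im (f t))%:C%C).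
  apply: V_add; first apply: RV_square_integrable => //.
    apply: le_integrable Ef => //.
      by apply/measurable_EFinP; exact: measurable_funX.
    move=> t _ /=; rewrite lee_fin !ger0_norm ?sqr_ge0 ?normsq_ge0 //.
    by rewrite lerDl sqr_ge0.
  apply: V_scale; apply: RV_square_integrable => //.
  apply: le_integrable Ef => //.
    by apply/measurable_EFinP; exact: measurable_funX.
  move=> t _ /=; rewrite lee_fin !ger0_norm ?sqr_ge0 ?normsq_ge0 //.
  by rewrite lerDr sqr_ge0.
apply/funext => t; case: (f t) => a b; apply/eqP; rewrite eq_complex /=.
by apply/andP; split; apply/eqP; ring.
Qed.

End Density.

(** * The self-similar measure *)

Section Characteristic.
Context {R : realType}.
Variable mu : probability (measurableTypeR R) R.
Implicit Types f g : R -> R[i].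

Definition cintegrable f : Prop :=
  mu.-integrable setT (fun t => (complex.Re (f t))%:E) /\
  mu.-integrable setT (fun t => (complex.Im (f t))%:E).

Lemma bounded_integrable (h : R -> R) (K : R) : measurable_fun [set: measurableTypeR R] h ->
  (forall t, `|h t| <= K) -> mu.-integrable setT (EFin \o h).
Proof.
move=> mh hK; apply: (@le_integrable _ _ _ mu setT measurableT _ (EFin \o cst K)).
- exact/measurable_EFinP.
- by move=> t _ /=; rewrite lee_fin; apply: le_trans (hK t) (ler_norm _).
- exact: finite_measure_integrable_cst.
Qed.

Lemma normsq_e2pi (x : R) : normsq (e2pi x) = 1.
Proof. by rewrite /normsq /e2pi /= cos2Dsin2. Qed.

Lemma cintegrable_exponential l : cintegrable (exponential l).
Proof.
have [m1 m2] := @cmeasurable_exponential R l.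
split; apply: (@bounded_integrable _ 1) => // t; rewrite /exponential /e2pi /=.
  by rewrite ler_norml cos_geN1 cos_le1.
by rewrite ler_norml sin_geN1 sin_le1.
Qed.

Lemma cintegrableD f g : cintegrable f -> cintegrable g -> cintegrable (fun t => f t + g t).
Proof.
move=> [f1 f2] [g1 g2]; split.
  rewrite (_ : (fun t => _) = (fun t => (complex.Re (f t))%:E + (complex.Re (g t))%:E)%E).
    exact: integrableD.
  by apply/funext => t; rewrite -EFinD; case: (f t) (g t) => [a b] [c d].
rewrite (_ : (fun t => _) = (fun t => (complex.Im (f t))%:E + (complex.Im (g t))%:E)%E).
  exact: integrableD.
by apply/funext => t; rewrite -EFinD; case: (f t) (g t) => [a b] [c d].
Qed.

Lemma cintegrableZ c f : cintegrable f -> cintegrable (fun t => c * f t).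
Proof.
case: c => x y [f1 f2]; split.
  rewrite (_ : (fun t => _) = (fun t => x%:E * (complex.Re (f t))%:E - y%:E * (complex.Im (f t))%:E)%E).
    by apply: integrableB => //; apply: integrableZl.
  by apply/funext => t; rewrite -!EFinM -EFinB; case: (f t) => a b.
rewrite (_ : (fun t => _) = (fun t => x%:E * (complex.Im (f t))%:E + y%:E * (complex.Re (f t))%:E)%E).
  by apply: integrableD => //; apply: integrableZl.
by apply/funext => t; rewrite -!EFinM -EFinD; case: (f t) => a b.
Qed.

Lemma cintegralD f g : cintegrable f -> cintegrable g ->
  cintegral mu (fun t => f t + g t) = cintegral mu f + cintegral mu g.
Proof.
move=> [f1 f2] [g1 g2]; apply/eqP; rewrite eq_complex /=; apply/andP; split; apply/eqP.
  rewrite -RintegralD //; apply: eq_Rintegral => t _.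
  by case: (f t) (g t) => [a b] [c d].
rewrite -RintegralD //; apply: eq_Rintegral => t _.
by case: (f t) (g t) => [a b] [c d].
Qed.

Lemma cintegralZ c f : cintegrable f ->
  cintegral mu (fun t => c * f t) = c * cintegral mu f.
Proof.
case: c => x y [f1 f2]; apply/eqP; rewrite eq_complex /=; apply/andP; split; apply/eqP.
  rewrite -!RintegralZl // -RintegralB //.
  - by apply: eq_Rintegral => t _; case: (f t) => a b.
  - exact: (integrableZl measurableT x f1).
  - exact: (integrableZl measurableT y f2).
rewrite -!RintegralZl // -RintegralD //.
- by apply: eq_Rintegral => t _; case: (f t) => a b.
- exact: (integrableZl measurableT x f2).
- exact: (integrableZl measurableT y f1).
Qed.

Definition muhat (l : R) : R[i] := cintegral mu (exponential l).

Lemma cintegral0 : cintegral mu (fun=> 0) = 0.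
Proof. by rewrite /cintegral !Rintegral_cst // !mul0r. Qed.

Lemma cintegrable0 : cintegrable (fun=> 0).
Proof. by split; exact: integrable0. Qed.

Lemma cintegrable_sum (s : seq (R[i] * R)) :
  cintegrable (fun t => \sum_(x <- s) x.1 * exponential x.2 t).
Proof.
elim: s => [|x s IH]; first by under eq_fun do rewrite big_nil; exact: cintegrable0.
under eq_fun do rewrite big_cons.
by apply: cintegrableD => //; apply: cintegrableZ; exact: cintegrable_exponential.
Qed.

Lemma cintegral_sum (s : seq (R[i] * R)) :
  cintegral mu (fun t => \sum_(x <- s) x.1 * exponential x.2 t) = \sum_(x <- s) x.1 * muhat x.2.
Proof.
elim: s => [|x s IH].
  by under eq_fun do rewrite big_nil; rewrite big_nil cintegral0.
under eq_fun do rewrite big_cons.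
have ix := cintegrable_exponential x.2.
rewrite cintegralD; [|exact: cintegrableZ|exact: cintegrable_sum].
by rewrite big_cons IH cintegralZ.
Qed.

Lemma muhat0 : muhat 0 = 1.
Proof.
rewrite /muhat /cintegral /exponential /e2pi; apply/eqP; rewrite eq_complex /=.
apply/andP; split; apply/eqP.
  under eq_Rintegral do rewrite mul0r mulr0 cos0.
  rewrite Rintegral_cst // mul1r -[RHS]/(fine 1%E); congr fine.
  exact: probability_setT.
under eq_Rintegral do rewrite mul0r mulr0 sin0.
by rewrite Rintegral_cst // mul0r.
Qed.

Lemma exponential_mulC l l' (t : R) :
  exponential l t * conjc (exponential l' t) = exponential (l - l') t.
Proof. by rewrite /exponential mulrBl e2piD e2piN. Qed.

Lemma L2dot_exponential l l' : L2dot mu (exponential l) (exponential l') = muhat (l - l').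
Proof. by rewrite /L2dot; under eq_fun do rewrite exponential_mulC. Qed.

Lemma muhatN l : muhat (- l) = conjc (muhat l).
Proof.
rewrite /muhat /cintegral /exponential /e2pi /=; congr Complex.
  by apply: eq_Rintegral => t _; rewrite mulNr mulrN cosN.
rewrite -mulN1r -RintegralZl //; last by have [] := cintegrable_exponential l.
by apply: eq_Rintegral => t _; rewrite mulNr mulrN sinN mulN1r.
Qed.

Lemma normsq_conj (z : R[i]) : normsq z = complex.Re (z * conjc z).
Proof. by case: z => a b; rewrite /normsq /=; ring. Qed.

Lemma energy_trigonometric (s : seq (R[i] * R)) :
  energy mu (fun t => \sum_(x <- s) x.1 * exponential x.2 t)
  = (complex.Re (\sum_(x <- s) \sum_(y <- s) x.1 * conjc y.1 * muhat (x.2 - y.2)))%:E.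
Proof.
pose s2 := [seq (x.1 * conjc y.1, x.2 - y.2) | x <- s, y <- s].
have E t : normsq (\sum_(x <- s) x.1 * exponential x.2 t)
    = complex.Re (\sum_(x <- s2) x.1 * exponential x.2 t).
  rewrite normsq_conj big_allpairs_dep; congr complex.Re.
  rewrite mulr_suml; apply: eq_bigr => x _; rewrite rmorph_sum mulr_sumr.
  by apply: eq_bigr => y _ /=; rewrite rmorphM mulrACA exponential_mulC.
have [i2 _] := cintegrable_sum s2.
rewrite (_ : \sum_(x <- s) _ = \sum_(x <- s2) x.1 * muhat x.2); last first.
  by rewrite big_allpairs_dep.
rewrite -cintegral_sum /= /Rintegral fineK; last exact: integrable_fin_num.
by apply: eq_integral => t _; rewrite E.
Qed.

(** Pythagoras: [muhat mu (x - l)] is the coefficient of [exponential x] along [exponential l], so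
    the function is the error of an orthogonal projection. *)
Lemma energy_projection (L : seq R) (x : R) :
  {in L &, forall l l', l != l' -> muhat (l - l') = 0} -> uniq L ->
  energy mu (fun t => exponential x t - \sum_(l <- L) muhat (x - l) * exponential l t)
  = (1 - \sum_(l <- L) normsq (muhat (x - l)))%:E.
Proof.
move=> orth uL; pose s := (1, x) :: [seq (- muhat (x - l), l) | l <- L].
rewrite (_ : (fun t => _) = fun t => \sum_(y <- s) y.1 * exponential y.2 t); last first.
  apply/funext => t; rewrite big_cons big_map mul1r; congr (_ + _).
  by rewrite -sumrN; apply: eq_bigr => l _; rewrite mulNr.
rewrite energy_trigonometric; congr EFin.
have nE (z : R[i]) : z * conjc z = (normsq z)%:C%C.
  by case: z => a b; apply/eqP; rewrite eq_complex /normsq /=; apply/andP; split; apply/eqP; ring.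
pose F (p q : R[i] * R) := p.1 * conjc q.1 * muhat (p.2 - q.2).
have FE a l b l' : F (a, l) (b, l') = a * conjc b * muhat (l - l') by [].
suff -> : \sum_(y <- s) \sum_(y' <- s) F y y'
    = (1 - \sum_(l <- L) normsq (muhat (x - l)))%:C%C by [].
rewrite big_cons big_cons !big_map FE subrr muhat0 conjc1 !mulr1.
under eq_bigr do rewrite FE mul1r raddfN mulNr mulrC nE.
(* The row of [l] in the Gram sum is 0: the error is orthogonal to [exponential l]. *)
under [X in _ + X]eq_big_seq => l lL.
  rewrite big_cons big_map FE conjc1 mulr1 -(opprB x l) muhatN mulNr nE.
  rewrite (bigD1_seq l) //= FE subrr muhat0 mulr1 big1_seq ?addr0; last first.
    move=> l' /andP[ll' l'L]; rewrite eq_sym in ll'.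
    by rewrite FE (orth l l' lL l'L ll') mulr0.
  rewrite raddfN mulrNN nE addNr; over.
by rewrite big1_eq addr0 rmorphB rmorph1 rmorph_sum -sumrN.
Qed.

End Characteristic.

Section SelfSimilar.
Context {R : realType}.
Variables (N : int) (D : {fset int}) (mu : probability (measurableTypeR R) R).
Hypothesis N0 : N != 0.
Hypothesis mu_ss : self_similar N D mu.
Local Notation q := (#|` D|%fset%:R : R).

Lemma measurable_phi d : measurable_fun [set: measurableTypeR R] (phi N d : measurableTypeR R -> measurableTypeR R).
Proof.
rewrite /phi; apply: measurable_funM; first exact: measurable_cst.
by apply: measurable_funD; [exact: measurable_id|exact: measurable_cst].
Qed.

Lemma self_similar_ge0_integral (f : R -> \bar R) :
  measurable_fun [set: measurableTypeR R] f -> (forall t, (0 <= f t)%E) ->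
  (\int[mu]_t f t = \sum_(d <- D) (q^-1)%:E * \int[mu]_t f (phi N d t))%E.
Proof.
move=> mf f0.
pose pf d : {measure set (measurableTypeR R) -> \bar R} :=
  measure_function_pushforward__canonical__measure_function_Measure mu (measurable_phi d).
have q0 : 0 <= q^-1 by rewrite invr_ge0.
pose m_ i : {measure set (measurableTypeR R) -> \bar R} := mscale (NngNum q0) (pf (nth 0 D i)).
transitivity (\int[msum m_ (size D)]_t f t)%E.
  apply: eq_measure_integral => A mA _.
  by rewrite (mu_ss mA) (big_nth 0) big_mkord.
rewrite ge0_integral_measure_sum // (big_nth 0) big_mkord; apply: eq_bigr => i _.
rewrite ge0_integral_mscale //=; congr (_ * _)%E.
by rewrite (ge0_integral_pushforward (measurable_phi _)).
Qed.

(** Adding [K] makes [h] nonnegative; [K] cancels at the end because [mu] is a probability and the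
    weights add up to 1. *)
Lemma self_similar_bounded_integral (h : R -> R) (K : R) :
  measurable_fun [set: measurableTypeR R] h -> (forall t, `|h t| <= K) -> (0 < #|` D|)%N ->
  \int[mu]_t h t = \sum_(d <- D) q^-1 * \int[mu]_t h (phi N d t).
Proof.
move=> mh hK D0.
have q0 : q != 0 by rewrite pnatr_eq0 -lt0n.
have hp d : mu.-integrable setT (fun t => (h (phi N d t))%:E).
  apply: (@bounded_integrable _ _ _ K) => //.
  by apply: (measurableT_comp mh); exact: measurable_phi.
have hi : mu.-integrable setT (EFin \o h) by exact: (@bounded_integrable _ _ _ K).
have ck : mu.-integrable setT (EFin \o cst K) by exact: finite_measure_integrable_cst.
have mu1 : fine (mu setT) = 1 by rewrite -[RHS]/(fine 1%E); congr fine; exact: probability_setT.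
have E := @self_similar_ge0_integral (fun t => (K + h t)%:E).
have K_int (g : R -> R) : mu.-integrable setT (EFin \o g) ->
    (\int[mu]_t (K + g t)%:E = (K + \int[mu]_t g t)%:E)%E.
  move=> ig; rewrite -[LHS]fineK; last first.
    by apply: integrable_fin_num => //; exact: (integrableD measurableT ck ig).
  congr EFin; rewrite -/(Rintegral mu setT (fun t => K + g t)) RintegralD //.
  by rewrite Rintegral_cst // mu1 mulr1.
have mKh : measurable_fun [set: measurableTypeR R] (fun t => (K + h t)%:E).
  by apply/measurable_EFinP; apply: measurable_funD => //; exact: measurable_cst.
have Kh0 t : (0 <= (K + h t)%:E)%E.
  by rewrite lee_fin; have := hK t; rewrite ler_norml; lra.
move: (E mKh Kh0); rewrite K_int //.
rewrite (eq_bigr (fun d => (q^-1 * (K + \int[mu]_t h (phi N d t)))%:E)); last first.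
  by move=> d _; rewrite (K_int (fun t => h (phi N d t)) (hp d)).
rewrite sumEFin => -[]; under [X in _ = X -> _]eq_bigr do rewrite mulrDr.
rewrite big_split /= big_const_seq count_predT iter_addr_0 -[_ * K *+ _]mulr_natr mulrAC.
by rewrite mulVf // mul1r => /addrI.
Qed.

Definition mask (x : R) : R[i] := q^-1%:C%C * \sum_(d <- D) e2pi (d%:~R * x).

Lemma muhat_refine l : (0 < #|` D|)%N ->
  muhat mu l = mask (l / N%:~R) * muhat mu (l / N%:~R).
Proof.
move=> D0; have NR : N%:~R != 0 :> R by rewrite intr_eq0.
have [mc ms] := @cmeasurable_exponential R l.
have int_phi d : cintegral mu (fun t => exponential l (phi N d t))
    = e2pi (d%:~R * (l / N%:~R)) * muhat mu (l / N%:~R).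
  rewrite /muhat -cintegralZ; last exact: cintegrable_exponential.
  congr cintegral; apply/funext => t.
  by rewrite /exponential /phi -e2piD; congr e2pi; field.
rewrite /mask -mulrA mulr_suml mulr_sumr.
transitivity (\sum_(d <- D) q^-1%:C%C * cintegral mu (fun t => exponential l (phi N d t))).
  rewrite /muhat /cintegral.
  rewrite (@self_similar_bounded_integral _ 1 mc) //; last first.
    by move=> t; rewrite ler_norml cos_geN1 cos_le1.
  rewrite (@self_similar_bounded_integral _ 1 ms) //; last first.
    by move=> t; rewrite ler_norml sin_geN1 sin_le1.
  move: (q^-1) => c; elim: (enum_fset D) => [|d s IH]; first by rewrite !big_nil.
  rewrite !big_cons -IH; apply/eqP; rewrite eq_complex /=.
  by apply/andP; split; apply/eqP; ring.
by apply: eq_bigr => d _; rewrite int_phi.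
Qed.

End SelfSimilar.

Section Continuity.
Context {R : realType}.
Variables (mu : probability (measurableTypeR R) R).

Lemma bounded_continuous_integral (h : R -> R) : continuous h -> (forall t, `|h t| <= 1) ->
  continuous (fun l : R => \int[mu]_t h (2 * pi * (l * t))).
Proof.
move=> ch h1 x.
have mh l : measurable_fun [set: measurableTypeR R] (fun t : R => h (2 * pi * (l * t))).
  apply: (measurableT_comp (continuous_measurable_fun ch)).
  by apply: measurable_funM => //; apply: measurable_funM.
have := @continuity_under_integral R _ _ mu (fun l t => h (2 * pi * (l * t))) setT measurableT
  (x - 1) (x + 1) _ _ (cst 1) _ _ x.
apply => //.
- move=> l _; exact: (@bounded_integrable _ _ _ 1).
- apply: aeW => t _ l _; apply: continuous_comp; last exact: ch.
  by apply: cvgMr; apply: cvgMl; exact: cvg_id.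
- exact: finite_measure_integrable_cst.
- by move=> l _; apply: aeW => t _; exact: h1.
- by rewrite inE /= in_itv /=; apply/andP; split; lra.
Qed.

Lemma continuous_normsq_muhat : continuous (fun l : R => normsq (muhat mu l)).
Proof.
have c1 : continuous (fun l : R => complex.Re (muhat mu l)).
  apply: (bounded_continuous_integral (@continuous_cos R)) => t.
  by rewrite ler_norml cos_geN1 cos_le1.
have c2 : continuous (fun l : R => complex.Im (muhat mu l)).
  apply: (bounded_continuous_integral (@continuous_sin R)) => t.
  by rewrite ler_norml sin_geN1 sin_le1.
by move=> x; apply: cvgD; [apply: cvgM; exact: c1|apply: cvgM; exact: c2].
Qed.

Lemma normsq_muhatN l : normsq (muhat mu (- l)) = normsq (muhat mu l).
Proof. by rewrite muhatN; case: (muhat mu l) => a b; rewrite /normsq /= sqrrN. Qed.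

End Continuity.

Section Gcd.

Definition gcd_seq (s : seq int) : int := foldr gcdz 0 s.

Lemma gcd_seq_dvd (s : seq int) a : a \in s -> (gcd_seq s %| a)%Z.
Proof.
elim: s => // b s IH; rewrite inE => /predU1P[->|/IH as_]; first exact: dvdz_gcdl.
by apply: dvdz_trans as_; exact: dvdz_gcdr.
Qed.

Lemma gcd_seq_integral {R : realType} (s : seq int) (x : R) :
  (forall a, a \in s -> exists k : int, a%:~R * x = k%:~R) ->
  exists k : int, (gcd_seq s)%:~R * x = k%:~R.
Proof.
elim: s => [|b s IH] H; first by exists 0; rewrite mul0r.
have [k Ek] := IH (fun a as_ => H a (mem_behead (as_ : a \in behead (b :: s)))).
have [k' Ek'] := H b (mem_head _ _).
have [u [v E]] := Bezoutz b (gcd_seq s).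
exists (u * k' + v * k); rewrite /= -E !intrD !intrM mulrDl -Ek' -Ek; ring.
Qed.

End Gcd.

Section Mask.
Context {R : realType}.
Local Notation e2pi := (@e2pi R).
Variables (N : int) (D : {fset int}) (S : seq int).
Hypothesis N0 : N != 0.
Hypothesis D0 : (0 < #|` D|)%N.
Hypothesis S_uniq : uniq S.
Hypothesis S_size : size S = #|` D|%fset.
Hypothesis S_orth : {in S &, forall s s', s != s' ->
  \sum_(d <- D) e2pi (d%:~R * ((s - s')%:~R / N%:~R)) = 0}.
Local Notation q := (#|` D|%fset%:R : R).
Let q0 : q != 0. Proof. by rewrite pnatr_eq0 -lt0n. Qed.
Let NR : N%:~R != 0 :> R. Proof. by rewrite intr_eq0. Qed.

Definition maskM (x : R) : R := normsq (mask D x).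

Lemma maskM_ge0 x : 0 <= maskM x. Proof. exact: normsq_ge0. Qed.

Lemma e2pi_conj_mul x y : e2pi x * conjc (e2pi y) = e2pi (x - y).
Proof. by rewrite e2piD e2piN. Qed.

(* A square matrix with orthonormal rows also has orthonormal columns. *)
Lemma dual_orthogonality d d' : d \in D -> d' \in D ->
  \sum_(s <- S) e2pi ((d - d')%:~R * (s%:~R / N%:~R)) = (d == d')%:R * q%:C%C.
Proof.
set n := #|` D|%fset.
pose H : 'M[R[i]]_n := \matrix_(i, j) e2pi ((nth 0 D j)%:~R * ((nth 0 S i)%:~R / N%:~R)).
pose H' : 'M[R[i]]_n := \matrix_(i, j) (q^-1%:C%C * conjc (H j i)).
have HH' : H *m H' = 1%:M.
  apply/matrixP => i j; rewrite !mxE.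
  have -> : \sum_k H i k * H' k j = q^-1%:C%C *
      \sum_(d <- D) e2pi (d%:~R * ((nth 0 S i - nth 0 S j)%:~R / N%:~R)).
    rewrite (big_nth 0) big_mkord mulr_sumr; apply: eq_bigr => k _.
    rewrite !mxE mulrCA e2pi_conj_mul; congr (_ * e2pi _).
    by rewrite intrD mulrNz; ring.
  have [->|ij] := eqVneq i j.
    rewrite subrr mul0r; under eq_bigr do rewrite mulr0 e2pi0.
    rewrite big_const_seq count_predT iter_addr_0.
    by rewrite -mulr_natl mulr1 -[in X in _ * X](rmorph_nat (@real_complex R)) -rmorphM mulVf.
  rewrite S_orth ?mulr0 ?mem_nth ?S_size //.
  by rewrite nth_uniq ?S_size //.
move=> /(nthP 0)[j jn <-] /(nthP 0)[j' j'n <-].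
have /matrixP/(_ (Ordinal j'n) (Ordinal jn)) := mulmx1C HH'.
rewrite mxE [RHS]mxE => E.
have {}E : \sum_k H' (Ordinal j'n) k * H k (Ordinal jn) = (j == j')%:R by rewrite E eq_sym.
rewrite nth_uniq ?fset_uniq // -E mulr_suml (big_nth 0) big_mkord S_size.
apply: eq_bigr => k _; rewrite !mxE.
have qq : q%:C%C * q^-1%:C%C = 1 :> R[i] by rewrite -rmorphM /= mulfV.
rewrite [RHS]mulrC !mulrA qq mul1r mulrC e2pi_conj_mul.
by congr e2pi; rewrite intrD mulrNz; ring.
Qed.

Lemma normsq_real (z : R[i]) : (normsq z)%:C%C = z * conjc z.
Proof.
case: z => a b; apply/eqP; rewrite eq_complex /normsq /=.
by apply/andP; split; apply/eqP; ring.
Qed.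

Lemma conjc_mul (z u : R[i]) : conjc (z * u) = conjc z * conjc u.
Proof. exact: rmorphM. Qed.

Lemma conjc_sum (I : Type) (s : seq I) (F : I -> R[i]) :
  conjc (\sum_(i <- s) F i) = \sum_(i <- s) conjc (F i).
Proof. exact: rmorph_sum. Qed.

(** In the squared modulus, expanded over pairs of digits, summation over [S] removes the pairs
    [d != d'] by [dual_orthogonality], and each of the [q] diagonal pairs contributes [1 / q]. *)
Lemma maskM_sum x : \sum_(s <- S) maskM ((x + s%:~R) / N%:~R) = 1.
Proof.
apply: (fmorph_inj (@real_complex R)); rewrite rmorph_sum rmorph1 /=.
pose F d d' := q^-1%:C%C * q^-1%:C%C * e2pi ((d - d')%:~R * (x / N%:~R)).
have E s : (maskM ((x + s%:~R) / N%:~R))%:C%C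
    = \sum_(d <- D) \sum_(d' <- D) F d d' * e2pi ((d - d')%:~R * (s%:~R / N%:~R)).
  rewrite normsq_real /mask conjc_mul conjc_sum mulrACA.
  have -> : conjc q^-1%:C%C = q^-1%:C%C :> R[i].
    by apply/eqP; rewrite eq_complex /= oppr0 !eqxx.
  rewrite mulr_suml mulr_sumr; apply: eq_bigr => d _.
  rewrite mulr_sumr mulr_sumr; apply: eq_bigr => d' _.
  rewrite e2pi_conj_mul /F -[RHS]mulrA -e2piD; congr (_ * _ * e2pi _).
  by rewrite intrD mulrNz; field.
under eq_bigr do rewrite E; rewrite exchange_big.
under eq_bigr do rewrite exchange_big.
rewrite (eq_big_seq (fun d => q^-1%:C%C)) => [|d dD /=].
  rewrite big_const_seq count_predT iter_addr_0 -[LHS]mulr_natr.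
  by rewrite -[in X in _ * X](rmorph_nat (@real_complex R)) -rmorphM mulVf.
rewrite (bigD1_seq d) ?fset_uniq //= -mulr_sumr dual_orthogonality // eqxx mul1r.
rewrite big1_seq => [|d' /andP[dd' d'D]]; last first.
  by rewrite -mulr_sumr dual_orthogonality // eq_sym (negPf dd') mul0r mulr0.
rewrite addr0 /F subrr mul0r e2pi0 mulr1 -mulrA.
by rewrite -[X in _ * X]rmorphM /= mulVf // mulr1.
Qed.

(* If [c] is the mean of unimodular numbers [u_d] and [|c| = 1], then
   [sum_d |u_d - c|^2 = 0]. *)
Lemma maskM_eq1 x d d' : maskM x = 1 -> d \in D -> d' \in D ->
  exists k : int, (d - d')%:~R * x = k%:~R.
Proof.
move=> M1 dD d'D; set c := mask D x.
have key : \sum_(d <- D) normsq (e2pi (d%:~R * x) - c) = 0.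
  have E e : (normsq (e2pi (e%:~R * x) - c))%:C%C
      = 1 + 1 - (e2pi (e%:~R * x) * conjc c + conjc (e2pi (e%:~R * x)) * c).
    have n1 := normsq_e2pi (e%:~R * x); have := normsq_real (e2pi (e%:~R * x)).
    have := normsq_real c; rewrite n1 -/(maskM x) M1 rmorph1 normsq_real.
    by rewrite rmorphB /= => {2}-> {1}->; ring.
  have qc : \sum_(d <- D) e2pi (d%:~R * x) = q%:C%C * c.
    by rewrite /c /mask mulrA -rmorphM mulfV // mul1r.
  have cc : c * conjc c = 1 by rewrite -normsq_real -/(maskM x) M1.
  have S1 : \sum_(d <- D) e2pi (d%:~R * x) * conjc c = q%:C%C.
    by rewrite -mulr_suml qc -mulrA cc mulr1.
  have S2 : \sum_(d <- D) conjc (e2pi (d%:~R * x)) * c = q%:C%C.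
    rewrite -mulr_suml -conjc_sum qc conjc_mul -mulrA [_ * c]mulrC cc mulr1.
    by apply/eqP; rewrite eq_complex /= oppr0 !eqxx.
  have S3 : \sum_(d <- D) (1 : R[i]) = q%:C%C.
    by rewrite big_const_seq count_predT iter_addr_0 rmorph_nat.
  apply: (fmorph_inj (@real_complex R)); rewrite rmorph_sum rmorph0.
  rewrite (eq_bigr _ (fun d _ => E d)) sumrB 2!big_split.
  by rewrite [X in X + _ - _]S3 [X in _ + X - _]S3 [X in _ - (X + _)]S1 [X in _ - (_ + X)]S2 subrr.
have eqc e : e \in D -> e2pi (e%:~R * x) = c.
  move=> eD; have : normsq (e2pi (e%:~R * x) - c) = 0.
    apply/eqP; move: key => /eqP; rewrite (big_rem e) //= paddr_eq0 ?normsq_ge0 //.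
      by case/andP.
    by apply: sumr_ge0 => *; exact: normsq_ge0.
  move=> n0; apply/eqP; rewrite -subr_eq0; move: n0; case: (_ - c) => a b /eqP.
  by rewrite /normsq paddr_eq0 ?sqr_ge0 //= !sqrf_eq0 eq_complex.
apply: e2pi_eq1; rewrite intrD mulrNz mulrBl e2piD e2piN !eqc //.
by rewrite -normsq_real -/(maskM x) M1.
Qed.

End Mask.

Section Zeros.
Context {R : realType}.
Local Notation e2pi := (@e2pi R).

Lemma finite_e2pi_preimage (z : R[i]) : finite_set [set x : R | -1 < x < 1 /\ e2pi x = z].
Proof.
have [[x0 [x01 Ex0]]|no] := pselect (exists x : R, -1 < x < 1 /\ e2pi x = z); last first.
  by rewrite (_ : [set x | _] = set0) // -subset0 => x H; apply: no; exists x.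
apply: (@sub_finite_set _ _ [set` [:: x0 - 1; x0; x0 + 1]]); last exact: finite_seq.
move=> x /= [x1 Ex]; have [k Ek] : exists k : int, x - x0 = k%:~R.
  by apply: e2pi_eq1; rewrite -e2pi_conj_mul Ex Ex0 -normsq_real -Ex0 normsq_e2pi.
have k2 : -2 < (k%:~R : R) < 2 by rewrite -Ek; lra.
have : k = -1 \/ k = 0 \/ k = 1.
  case/andP: k2 => k2 k2'.
  have h1 : -2 < k by rewrite -(ltr_int R) rmorphN.
  have h2 : k < 2 by rewrite -(ltr_int R).
  by lia.
rewrite !inE => -[|[|]] k1; apply/or3P; [apply: Or31|apply: Or32|apply: Or33]; apply/eqP;
  by move: Ek; rewrite k1; lra.
Qed.

(** Multiplication by [e2pi (K x)] makes all exponents nonnegative, so [e2pi x] is a root of [P] at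
    every zero; [P] is nonzero since its value at 1 is [size s]. *)
Lemma finite_trigonometric_zeros (s : seq int) : s != [::] ->
  finite_set [set x : R | -1 < x < 1 /\ \sum_(a <- s) e2pi (a%:~R * x) = 0].
Proof.
move=> s0; pose K := (\sum_(a <- s) `|a|)%N.
have aK a : a \in s -> 0 <= a + K%:Z.
  move=> as_; have : (`|a| <= K)%N by rewrite /K (big_rem a) //= leq_addr.
  by lia.
pose P : {poly R[i]} := \sum_(a <- s) 'X^`|a + K%:Z|.
have P0 : P != 0.
  apply/eqP => /(congr1 (fun p => p.[1])); rewrite horner0 horner_sum.
  rewrite (eq_bigr (fun=> 1)) => [|a _]; last by rewrite hornerXn expr1n.
  rewrite big_const_seq count_predT iter_addr_0 => /eqP.
  by rewrite pnatr_eq0 size_eq0 (negPf s0).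
have [r Er] := closed_field_poly_normal P.
apply: (@sub_finite_set _ _ (\bigcup_(z in [set` r]) [set x : R | -1 < x < 1 /\ e2pi x = z])).
  move=> x [x1 sx]; exists (e2pi x) => //=.
  have : root P (e2pi x).
    rewrite /root horner_sum (eq_big_seq (fun a => e2pi (K%:R * x) * e2pi (a%:~R * x))).
      by rewrite -mulr_sumr sx mulr0.
    move=> a as_; rewrite hornerXn e2piX -e2piD; congr e2pi.
    by rewrite -mulrDl [in LHS]pmulrn gez0_abs ?aK // intrD addrC pmulrn.
  by rewrite Er rootZ ?lead_coef_eq0 // root_prod_XsubC.
by apply: bigcup_finite => [|z _]; [exact: finite_seq|exact: finite_e2pi_preimage].
Qed.

Variables (D : {fset int}) (d0 g : int).
Hypothesis g0 : g != 0.
Hypothesis Dg : forall d, d \in D -> (g %| d - d0)%Z.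
Let gR : g%:~R != 0 :> R. Proof. by rewrite intr_eq0. Qed.

(** Translating the digits by [d0] costs a factor of modulus 1, and the remaining sum has integer
    frequencies, hence period 1. *)
Lemma mask_shift (x : R) : mask D (x / g%:~R) = #|` D|%fset%:R^-1%:C%C *
  (e2pi (d0%:~R * (x / g%:~R)) * \sum_(d <- D) e2pi (((d - d0) %/ g)%Z%:~R * x)).
Proof.
rewrite /mask; congr (_ * _); rewrite mulr_sumr; apply: eq_big_seq => d dD.
rewrite -e2piD; congr e2pi; have /divzK E := Dg dD.
by rewrite -[X in X%:~R * _ = _](subrK d0) -{1}E intrD intrM; field.
Qed.

Lemma maskM_periodic (x : R) (k : int) : maskM D ((x + k%:~R) / g%:~R) = maskM D (x / g%:~R).
Proof.
rewrite /maskM !mask_shift !normsqM !normsq_e2pi; congr (_ * (_ * normsq _)).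
apply: eq_bigr => d _; rewrite mulrDr e2piD -[X in _ * e2pi X]intrM e2pi_int mulr1 //.
Qed.

Lemma maskM_zeros_finite : (0 < #|` D|)%N ->
  finite_set [set x : R | -1 < x < 1 /\ maskM D (x / g%:~R) = 0].
Proof.
move=> D0; apply: (@sub_finite_set _ _ [set x : R | -1 < x < 1 /\
  \sum_(a <- [seq ((d - d0) %/ g)%Z | d <- D]) e2pi (a%:~R * x) = 0]); last first.
  by apply: finite_trigonometric_zeros; rewrite -size_eq0 size_map -lt0n.
move=> x [x1 Mx]; split=> //; rewrite big_map.
move: Mx; rewrite /maskM mask_shift !normsqM normsq_e2pi mul1r => /eqP.
rewrite mulf_eq0 normsqC sqrf_eq0 invr_eq0 pnatr_eq0 gtn_eqF //=.
case: (\sum_(d <- D) _) => a b; rewrite /normsq /= paddr_eq0 ?sqr_ge0 // !sqrf_eq0.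
by case/andP=> /eqP-> /eqP->.
Qed.

End Zeros.

(** * Completeness of nested orthonormal exponentials *)

Section Completeness.
Context {R : realType}.
Variable mu : probability (measurableTypeR R) R.
Variable L : nat -> seq R.
Hypothesis L_uniq : forall n, uniq (L n).
Hypothesis L_orth : forall n, {in L n &, forall l l', l != l' -> muhat mu (l - l') = 0}.
Hypothesis L_nested : forall m n, (m <= n)%N -> {subset L m <= L n}.
Hypothesis L_limit : forall x d, 0 < d -> exists n, forall m, (n <= m)%N ->
  1 - d <= \sum_(l <- L m) normsq (muhat mu (x - l)).

Definition combination n (c : R -> R[i]) (t : R) : R[i] :=
  \sum_(l <- L n) c l * exponential l t.

(** Approximation is demanded on every list from some index on, so that two functions can be treated
    over a common [L m]. *)
Definition approximable (f : R -> R[i]) : Prop := cmeasurable f /\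
  forall e, 0 < e -> exists n, forall m, (n <= m)%N ->
    exists c, (energy mu (fun t => (f t - combination m c t)%R) < e%:E)%E.

Lemma cmeasurable_combination n c : cmeasurable (combination n c).
Proof.
rewrite /combination; elim: (L n) => [|l s IH].
  by under eq_fun do rewrite big_nil; exact: cmeasurable_cst.
under eq_fun do rewrite big_cons.
apply: cmeasurableD => //; apply: cmeasurableM; first exact: cmeasurable_cst.
exact: cmeasurable_exponential.
Qed.

Lemma approximable_exponential x : approximable (exponential x).
Proof.
split=> [|e e0]; first exact: cmeasurable_exponential.
have [n nP] := L_limit x (divr_gt0 e0 (ltr0Sn R 1)).
exists n => m nm; exists (fun l => muhat mu (x - l)).
rewrite (energy_projection x (@L_orth m) (L_uniq m)).
by rewrite lte_fin; have := nP m nm; lra.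
Qed.

Lemma approximableD f g : approximable f -> approximable g ->
  approximable (fun t => f t + g t).
Proof.
move=> [mf Hf] [mg Hg]; split=> [|e e0]; first exact: cmeasurableD.
have e4 : 0 < e / 4 by rewrite divr_gt0.
have [n1 H1] := Hf _ e4; have [n2 H2] := Hg _ e4.
exists (maxn n1 n2) => m; rewrite geq_max => /andP[/H1[c1 Ec1] /H2[c2 Ec2]].
exists (fun l => c1 l + c2 l).
rewrite (_ : (fun t => _) = fun t => (f t - combination m c1 t) + (g t - combination m c2 t)).
  apply: le_lt_trans (energyD _ _ _) _.
  - by apply: cmeasurableB => //; exact: cmeasurable_combination.
  - by apply: cmeasurableB => //; exact: cmeasurable_combination.
  have -> : e%:E = (2%:E * (e / 4)%:E + 2%:E * (e / 4)%:E)%E.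
    by rewrite -!EFinM -EFinD; congr EFin; field.
  by apply: lteD; rewrite lte_pmul2l.
apply/funext => t; rewrite addrACA -opprD; congr (_ - _).
by rewrite -big_split; apply: eq_bigr => l _; rewrite mulrDl.
Qed.

Lemma approximableZ c f : approximable f -> approximable (fun t => c * f t).
Proof.
move=> [mf Hf]; split=> [|e e0].
  by apply: cmeasurableM => //; exact: cmeasurable_cst.
have c1 : 0 < normsq c + 1 by rewrite ltr_wpDl ?normsq_ge0.
have [n H] := Hf _ (divr_gt0 e0 c1); exists n => m /H[b Eb].
exists (fun l => c * b l).
rewrite (_ : (fun t => _) = fun t => c * (f t - combination m b t)); last first.
  apply/funext => t; rewrite mulrBr mulr_sumr; congr (_ - _).
  by apply: eq_bigr => l _; rewrite mulrA.
rewrite energyZ; last by apply: cmeasurableB => //; exact: cmeasurable_combination.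
apply: (@le_lt_trans _ _ ((normsq c + 1)%:E * energy mu (fun t => (f t - combination m b t)%R))%E).
  by apply: lee_wpmul2r; [exact: energy_ge0|rewrite lee_fin lerDl].
by rewrite -[e](divfK (lt0r_neq0 c1)) [_ / _ * _]mulrC EFinM lte_pmul2l.
Qed.

Lemma approximable_closed f : cmeasurable f ->
  (forall e, 0 < e -> exists2 g, approximable g & (energy mu (fun t => (f t - g t)%R) < e%:E)%E) ->
  approximable f.
Proof.
move=> mf H; split=> // e e0.
have e4 : 0 < e / 4 by rewrite divr_gt0.
have [g [mg Hg] Eg] := H _ e4; have [n Hn] := Hg _ e4.
exists n => m /Hn[c Ec]; exists c.
rewrite (_ : (fun t => _) = fun t => (f t - g t) + (g t - combination m c t)).
  apply: le_lt_trans (energyD _ _ _) _.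
  - exact: cmeasurableB.
  - by apply: cmeasurableB => //; exact: cmeasurable_combination.
  have -> : e%:E = (2%:E * (e / 4)%:E + 2%:E * (e / 4)%:E)%E.
    by rewrite -!EFinM -EFinD; congr EFin; field.
  by apply: lteD; rewrite lte_pmul2l.
by apply/funext => t; rewrite addrA subrK.
Qed.

Lemma nested_spectral : spectral_measure mu.
Proof.
exists [set l | exists n, l \in L n]; split.
  move=> l l' [n ln] [n' l'n]; rewrite L2dot_exponential.
  have [<-|ll'] := eqVneq l l'; first by rewrite subrr muhat0.
  apply: (@L_orth (maxn n n')) => //; [exact: L_nested (leq_maxl _ _) _ ln|exact: L_nested (leq_maxr _ _) _ l'n].
move=> f L2f e e0.
have [_ Hf] : approximable f.
  apply: (V_L2 (V := approximable)) L2f.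
  - by move=> g [].
  - exact: approximable_exponential.
  - exact: approximableD.
  - exact: approximableZ.
  - exact: approximable_closed.
have [n /(_ n (leqnn n))[c Ec]] := Hf _ (exprn_gt0 2 e0).
exists (L n), c; split; first by move=> l ln; exists n.
exact: energy_L2norm_lt.
Qed.

End Completeness.

(** For a single digit the gcd of the differences is 0 and [g = 1] is a placeholder; no integrality
    can be deduced then, hence the separate alternative. *)
Lemma difference_gcd {R : realType} (D : {fset int}) : (0 < #|` D|)%N -> exists d0 g : int,
  [/\ d0 \in D, g != 0, forall d, d \in D -> (g %| d - d0)%Z &
    (forall d, d \in D -> d = d0) \/
    (forall x : R, (forall d, d \in D -> exists k : int, (d - d0)%:~R * x = k%:~R) ->
       exists k : int, g%:~R * x = k%:~R)].
Proof.
rewrite cardfs_gt0 => /fset0Pn[d0 d0D]; exists d0.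
pose s := [seq d - d0 | d <- D].
have [g0|gn0] := eqVneq (gcd_seq s) 0.
  exists 1; split=> //; left=> d dD; have : (gcd_seq s %| d - d0)%Z by apply: gcd_seq_dvd; apply: map_f.
  by rewrite g0 dvd0z subr_eq0 => /eqP.
exists (gcd_seq s); split=> // [d dD|]; first by apply: gcd_seq_dvd; apply: map_f.
right=> x H; apply: gcd_seq_integral => _ /mapP[d dD ->]; exact: H.
Qed.

Theorem theorem1p4 (R : realType) (N : int) (D : {fset int})
  (mu : probability (measurableTypeR R) R) :
  1 < `|N| ->
  complementing N [set` D] ->
  (size (primes #|` D|%fset) <= 2)%N ->
  self_similar N D mu ->
  spectral_measure mu.
Proof.
move=> N1 cND D2 ss.
have N0 : N != 0 by rewrite -normr_gt0 (lt_trans _ N1).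
have NR : N%:~R != 0 :> R by rewrite intr_eq0.
have D0 : (0 < #|` D|)%N.
  have [E [_ /(_ 0)[s [[[d dD _] _] _]]]] := cND.
  by rewrite cardfs_gt0; apply/fset0Pn; exists d.
have [S [uS sS orthS]] := @complementing_compatible R N D N1 cND D2.
have [d0 [g [d0D g0 gD gcase]]] := @difference_gcd R D D0.
have gR : g%:~R != 0 :> R by rewrite intr_eq0.
(* The scale [1 / g] gives [M] period 1 and, for at least two digits, the value 1 only at
   integers. *)
pose w (x : R) := normsq (muhat mu (x / g%:~R)).
pose M (x : R) := maskM D (x / g%:~R).
have [s0 [S' ES]] : exists s0 S', S = s0 :: S'.
  by move: D0; rewrite -sS; case: (S) => // s0 S' _; exists s0, S'.
(* Subtracting [s0] puts the digit 0 into the set; the factor [g] compensates the scale [1 / g]. *)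
pose S1 := [seq g * (s - s0) | s <- S].
have S1E : S1 = 0 :: [seq g * (s - s0) | s <- S'] by rewrite /S1 ES /= subrr mulr0.
have w_cont : continuous w.
  move=> x; apply: (@continuous_comp _ _ _ (fun x : R => x / g%:~R) (fun l => normsq (muhat mu l))).
    by apply: cvgMl; exact: cvg_id.
  exact: continuous_normsq_muhat.
have w0 : w 0 = 1.
  by rewrite /w mul0r muhat0 -(rmorph1 (@real_complex R)) normsqC expr1n.
have w_ge0 x : 0 <= w x by exact: normsq_ge0.
have M_ge0 x : 0 <= M x by exact: maskM_ge0.
have w_refine x : w x = M (x / N%:~R) * w (x / N%:~R).
  by rewrite /w (muhat_refine N0 ss) // normsqM /M /maskM (mulrAC x N%:~R^-1).
have M_per (x : R) (k : int) : M (x + k%:~R) = M x := maskM_periodic g0 gD x k.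
have M_sum (x : R) : \sum_(s <- S1) M ((x + s%:~R) / N%:~R) = 1.
  rewrite big_map -[RHS](maskM_sum N0 D0 uS sS orthS (x / g%:~R - s0%:~R)).
  apply: eq_bigr => s _; rewrite /M; congr maskM.
  by rewrite intrM intrD mulrNz; field; rewrite NR.
have uS1 : uniq S1.
  by rewrite map_inj_uniq // => s s' /(mulfI g0)/addIr.
have M_orth : {in S1 &, forall s s', s != s' -> M ((s - s')%:~R / N%:~R) = 0}.
  move=> _ _ /mapP[s sS1 ->] /mapP[s' s'S1 ->] ss'.
  have {}ss' : s != s' by apply: contra ss' => /eqP ->.
  rewrite /M /maskM /mask.
  have -> : (g * (s - s0) - g * (s' - s0))%:~R / N%:~R / g%:~R = (s - s')%:~R / N%:~R :> R.
    by rewrite -mulrBr opprB addrA subrK intrM; field; rewrite NR.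
  by rewrite orthS // mulr0 -(rmorph0 (@real_complex R)) normsqC expr0n.
have nz x : exists k : int, w (x + k%:~R) != 0.
  case: gcase => [single|gint].
    (* For a single digit [M] is constantly 1, so [w x] equals [w] at points tending to 0. *)
    have M1 y : M y = 1.
      rewrite /M /maskM /mask (eq_big_seq (fun=> e2pi (d0%:~R * (y / g%:~R)))); last first.
        by move=> d /single ->.
      rewrite big_const_seq count_predT iter_addr_0 -[X in _ * X]mulr_natl.
      rewrite -[X in _ * (X * _)](rmorph_nat (@real_complex R)) mulrA -rmorphM.
      by rewrite mulVf ?pnatr_eq0 -?lt0n // rmorph1 mul1r normsq_e2pi.
    have near_w : \forall y \near 0, w y != 0.
      by have := @w_cont 0 => /cvgr_neq0; apply; rewrite w0 oner_neq0.
    have [n /(_ n (leqnn n)) wn] := near0_scaled N1 x near_w.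
    exists 0; rewrite addr0 (w_refine_iter w_refine n) big1 ?mul1r // => i _; exact: M1.
  apply: (no_periodic_zero N1 w_cont w0 M_ge0 w_refine M_per M_sum uS1 M_orth).
    move=> y My; have [d dD|k Ek] := gint (y / g%:~R).
      exact: (maskM_eq1 D0 My dD d0D).
    by exists k; rewrite -Ek; field.
  exact: (maskM_zeros_finite g0 gD D0).
have [L [L1 L2 L3 L4]] := frequencies_exist N1 w_cont w0 w_ge0 M_ge0 w_refine M_per M_sum S1E nz.
pose F (l : int) : R := l%:~R / g%:~R.
have F_inj : injective F by move=> l l' /(mulIf (invr_neq0 gR))/intr_inj.
apply: (@nested_spectral R mu (fun n => map F (L n))).
- by move=> n; rewrite map_inj_uniq.
- move=> n _ _ /mapP[l lL ->] /mapP[l' l'L ->] ll'.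
  have {}ll' : l != l' by apply: contra ll' => /eqP ->.
  have := L2 n l l' lL l'L ll'; rewrite /w intrD mulrNz mulrBl.
  case: (muhat mu _) => a b /eqP; rewrite /normsq paddr_eq0 ?sqr_ge0 // !sqrf_eq0 /=.
  by case/andP=> /eqP-> /eqP->.
- move=> m n /L3[T ->] _ /mapP[l lL ->]; apply: map_f.
  by rewrite mem_cat lL.
(* [w (- g x + l)] is the squared modulus of [muhat] at [l / g - x], which is even in its
   argument. *)
- move=> x d d_gt0; have [n nP] := L4 (- (g%:~R * x)) d d_gt0.
  exists n => m /nP; rewrite big_map => /le_trans; apply.
  apply: ler_sum => l _; rewrite /w -normsq_muhatN /F.
  by rewrite le_eqVlt; apply/orP; left; apply/eqP; congr (normsq (muhat mu _)); field.
Qed.
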